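(* Let $k$ be an algebraically closed field, let $G$ be an affine group scheme over $k$ (not assumed to be of finite type), and let $X$ be a $G$-torsor. Then $X$ is trivial, i.e., $X(k)\neq\emptyset$.
   Context: All schemes, group schemes, products and morphisms are over the field $k$. A $G$-space is a scheme $X$ together with a right action $X\times G\to X,\ (x,g)\mapsto x.g$, of $G$. A $G$-torsor is a non-empty $G$-space $X$ such that the morphism $X\times G\to X\times X,\ (x,g)\mapsto (x,x.g)$ is an isomorphism. *)

(* Defs.v *)
(* Schemes over k are taken in the functor-of-points sense of Demazure-Gabriel
   (Groupes algebriques, I.1; see also Jantzen, Representations of Algebraic
   Groups, I.1): k-functors that are sheaves for the Zariski topology and are
   covered by open affine subfunctors.  A morphism of schemes is a natural
   transformation, the product of two schemes is the pointwise product, and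
   X(R) is the set of R-valued points of X. *)
From HB Require Import structures.
From mathcomp Require Import all_boot all_algebra.
From mathcomp Require Import boolp.

Set Implicit Arguments.
Unset Strict Implicit.
Unset Printing Implicit Defensive.

Import GRing.Theory.
Local Open Scope ring_scope.

(* Unlike comAlgType k, this includes the zero algebra, which is needed for
   localizations and for empty (sub)schemes. *)
Record kalg (k : fieldType) := KAlg {
  kalg_ring :> comPzRingType;
  kalg_str : {rmorphism k -> kalg_ring} }.

Record khom (k : fieldType) (A B : kalg k) := KHom {
  khom_fun :> {rmorphism A -> B};
  khom_str : forall c : k, khom_fun (kalg_str A c) = kalg_str B c }.

Definition kalg_base (k : fieldType) : kalg k :=
  @KAlg k k (idfun : {rmorphism k -> k}).

Definition khom_id (k : fieldType) (A : kalg k) : khom A A :=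
  @KHom k A A (idfun : {rmorphism A -> A}) (fun=> erefl).

Lemma khom_comp_str (k : fieldType) (A B C : kalg k)
  (g : khom B C) (f : khom A B) (c : k) :
  (g \o f) (kalg_str A c) = kalg_str C c.
Proof. by rewrite /= !khom_str. Qed.

Definition khom_comp (k : fieldType) (A B C : kalg k)
    (g : khom B C) (f : khom A B) : khom A C :=
  @KHom k A C (g \o f : {rmorphism A -> C}) (khom_comp_str g f).

Lemma khomP (k : fieldType) (A B : kalg k) (f g : khom A B) : f =1 g -> f = g.
Proof.
case: f g => [[f [cf cf']] sf] [[g [cg cg']] sg] /= /funext fg.
move: cf cf' sf; rewrite {}fg => cf cf' sf.
case: cf sf => cf sf; case: cg sg => cg sg.
case: cf' sf => cf' sf; case: cg' sg => cg' sg.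
rewrite (Prop_irrelevance cg cf) (Prop_irrelevance cg' cf') in sg *.
by rewrite (Prop_irrelevance sf sg).
Qed.

Definition is_field (k : fieldType) (K : kalg k) : Prop :=
  (1 : K) <> 0 /\ forall x : K, x <> 0 -> exists y : K, x * y = 1.

(* E generates the unit ideal of R. *)
Definition generates_unit_ideal (R : comPzRingType) (E : R -> Prop) : Prop :=
  exists (n : nat) (a e : 'I_n -> R),
    (forall i, E (e i)) /\ \sum_(i < n) a i * e i = 1.

(* h : R -> S exhibits S as the localization R_f. *)
Definition is_localization (k : fieldType) (R S : kalg k) (f : R)
    (h : khom R S) : Prop :=
  [/\ exists u : S, h f * u = 1,
      forall s : S, exists (m : nat) (r : R), s * h f ^+ m = h r &
      forall r : R, h r = 0 -> exists m : nat, f ^+ m * r = 0].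

Record kfunctor (k : fieldType) := KFunctor {
  points :> kalg k -> Type;
  pmap : forall R S : kalg k, khom R S -> points R -> points S;
  pmap_id : forall (R : kalg k) (x : points R), pmap (khom_id R) x = x;
  pmap_comp : forall (R S T : kalg k) (g : khom S T) (f : khom R S)
    (x : points R), pmap (khom_comp g f) x = pmap g (pmap f x) }.
Arguments pmap {k} _ {R S} _ _.

Record morphism (k : fieldType) (X Y : kfunctor k) := Morphism {
  mor :> forall R : kalg k, X R -> Y R;
  mor_nat : forall (R S : kalg k) (f : khom R S) (x : X R),
    mor (pmap X f x) = pmap Y f (mor x) }.
Arguments mor {k X Y} _ {R} _.

Definition is_iso (k : fieldType) (X Y : kfunctor k) (f : morphism X Y) : Prop :=
  exists g : morphism Y X,
    (forall (R : kalg k) (x : X R), mor g (mor f x) = x) /\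
    (forall (R : kalg k) (y : Y R), mor f (mor g y) = y).

Definition Spec (k : fieldType) (A : kalg k) : kfunctor k.
Proof.
exists (fun R => khom A R) (fun R S f x => khom_comp f x).
- by move=> R x; apply: khomP.
- by move=> R S T g f x; apply: khomP.
Defined.

Definition prodF (k : fieldType) (X Y : kfunctor k) : kfunctor k.
Proof.
exists (fun R => (X R * Y R)%type) (fun R S f p => (pmap X f p.1, pmap Y f p.2)).
- by move=> R [x y]; rewrite !pmap_id.
- by move=> R S T g f [x y]; rewrite !pmap_comp.
Defined.

Record subfunctor (k : fieldType) (X : kfunctor k) := Subfunctor {
  in_sub :> forall R : kalg k, X R -> Prop;
  sub_stable : forall (R S : kalg k) (f : khom R S) (x : X R),
    in_sub x -> in_sub (pmap X f x) }.
Arguments in_sub {k X} _ {R} _.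

Definition subF (k : fieldType) (X : kfunctor k) (U : subfunctor X) : kfunctor k.
Proof.
exists (fun R => {x : X R | in_sub U x})
  (fun R S f x => exist _ (pmap X f (sval x)) (sub_stable f (svalP x))).
- by move=> R [x Ux]; apply: eq_exist; rewrite /= pmap_id.
- by move=> R S T g f [x Ux]; apply: eq_exist; rewrite /= pmap_comp.
Defined.

Definition is_affine (k : fieldType) (X : kfunctor k) : Prop :=
  exists (A : kalg k) (f : morphism (Spec A) X), is_iso f.

(* U is open in X: for every x : Spec R -> X (that is, x in X(R)), the inverse
   image of U is D(E) for some subset E of R, where D(E)(S) consists of the
   f : R -> S such that f(E) generates the unit ideal of S. *)
Definition is_open (k : fieldType) (X : kfunctor k) (U : subfunctor X) : Prop :=
  forall (R : kalg k) (x : X R), exists E : R -> Prop,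
    forall (S : kalg k) (f : khom R S),
      in_sub U (pmap X f x) <->
      generates_unit_ideal (fun s : S => exists2 r : R, E r & s = f r).

(* Zariski sheaf: if f_1, ..., f_n generate the unit ideal of R, then
   X(R) -> prod_i X(R_{f_i}) => prod_{i,j} X(R_{f_i f_j}) is exact. *)
Definition is_local (k : fieldType) (X : kfunctor k) : Prop :=
  forall (R : kalg k) (n : nat) (f : 'I_n -> R),
    (exists a : 'I_n -> R, \sum_(i < n) a i * f i = 1) ->
  forall (S : 'I_n -> kalg k) (loc : forall i, khom R (S i)),
    (forall i, is_localization (f i) (loc i)) ->
  forall x : forall i, X (S i),
    (forall (i j : 'I_n) (T : kalg k) (p : khom (S i) T) (q : khom (S j) T),
       khom_comp p (loc i) = khom_comp q (loc j) ->
       is_localization (f i * f j) (khom_comp p (loc i)) ->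
       pmap X p (x i) = pmap X q (x j)) ->
  exists! y : X R, forall i, pmap X (loc i) y = x i.

(* Subfunctors U_i cover X when they do so on field-valued points, i.e. on the
   points of the underlying topological space. *)
Definition is_scheme (k : fieldType) (X : kfunctor k) : Prop :=
  is_local X /\
  exists (I : Type) (U : I -> subfunctor X),
    (forall i, is_open (U i) /\ is_affine (subF (U i))) /\
    (forall K : kalg k, is_field K -> forall x : X K, exists i, in_sub (U i) x).

(* The underlying topological space of X is nonempty. *)
Definition nonempty (k : fieldType) (X : kfunctor k) : Prop :=
  exists K : kalg k, is_field K /\ inhabited (X K).

(* A group object; the unit is a k-point, i.e. a morphism Spec k -> G. *)
Record group_scheme (k : fieldType) := GroupScheme {
  gs_fun :> kfunctor k;
  gs_scheme : is_scheme gs_fun;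
  gs_mul : morphism (prodF gs_fun gs_fun) gs_fun;
  gs_one : morphism (Spec (kalg_base k)) gs_fun;
  gs_inv : morphism gs_fun gs_fun;
  gs_mulA : forall (R : kalg k) (x y z : gs_fun R),
    mor gs_mul (x, mor gs_mul (y, z)) = mor gs_mul (mor gs_mul (x, y), z);
  gs_mul1 : forall (R : kalg k) (e : Spec (kalg_base k) R) (x : gs_fun R),
    mor gs_mul (mor gs_one e, x) = x /\ mor gs_mul (x, mor gs_one e) = x;
  gs_mulV : forall (R : kalg k) (e : Spec (kalg_base k) R) (x : gs_fun R),
    mor gs_mul (mor gs_inv x, x) = mor gs_one e /\
    mor gs_mul (x, mor gs_inv x) = mor gs_one e }.

Record gspace (k : fieldType) (G : group_scheme k) := GSpace {
  sp_fun :> kfunctor k;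
  sp_scheme : is_scheme sp_fun;
  sp_act : morphism (prodF sp_fun G) sp_fun;
  sp_act1 : forall (R : kalg k) (e : Spec (kalg_base k) R) (x : sp_fun R),
    mor sp_act (x, mor (gs_one G) e) = x;
  sp_actM : forall (R : kalg k) (x : sp_fun R) (g h : G R),
    mor sp_act (x, mor (gs_mul G) (g, h)) = mor sp_act (mor sp_act (x, g), h) }.

(* (x, g) |-> (x, x.g) *)
Definition torsor_map (k : fieldType) (G : group_scheme k) (X : gspace G) :
  morphism (prodF X G) (prodF X X).
Proof.
exists (fun R (p : prodF X G R) => (p.1, mor (sp_act X) p)).
by move=> R S f p; rewrite mor_nat.
Defined.

Definition is_torsor (k : fieldType) (G : group_scheme k) (X : gspace G) : Prop :=
  nonempty X /\ is_iso (torsor_map X).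

(* Main.v *)
Require Import Defs.
From HB Require Import structures.
From mathcomp Require Import all_boot all_algebra.
From mathcomp Require Import boolp classical_sets.

(** Why every torsor has a rational point.

    Forget the group: on a torsor [X] the ternary operation
    [t (x, y, z) = x g], where [y g = z], is again a point of [X].  It makes [X]
    a heap, an affine heap once [X] is known to descend from a field extension,
    and the theorem becomes: a nonzero [k]-algebra [B] whose spectrum is a heap
    has a [k]-point when [k] is algebraically closed ([heap_has_point]).  The
    gain is that subtorsors under all subgroups are the closed subheaps, a class
    stable under intersections of chains.  Since an ideal is proper as soon as it
    avoids [1], such an intersection is nonempty, and Zorn's lemma gives a
    minimal nonempty closed subheap.  It remains to see that a function [b] on a
    heap is constant on some nonempty closed subheap
    ([function_constant_on_subheap]): on a minimal one all functions are then
    constant, and a minimal one is a [k]-point.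

    For this, translates of [b] span a finite-dimensional space, so [b] lies in a
    finitely generated subalgebra [D] of [B] stable under the heap operation
    ([function_in_finitely_generated_heap]): geometrically, a quotient heap of
    finite type.  By the Nullstellensatz [D] has a [k]-point [f], and the fibre
    over [f] is a closed subheap on which [b] is constant.  What could fail is
    that the fibre be nonempty.  Write [x z^-1 w] for [t (x, z, w)].  Restriction
    from points of [B] to points of [D] is dominant because [D] embeds in [B];
    the map [(z, w) |-> f z^-1 w] to points of [D] is dominant as well, because
    putting [z = f] gives the identity in [w].  Two dominant maps have a common
    value in some extension ([amalgam], by passing to a minimal prime and
    tensoring residue fields), say [u = f z^-1 w] on [D], and then [u w^-1 z] is a
    point of the fibre.

    The passage from torsors to heaps is descent.  Fix [x] in [X (K)] for a field
    [K] over [k].  The points of [X] over [K (x) T] whose pullbacks to all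
    [R] depend only on [T -> R] form a functor of [T].  It is represented by an
    explicit subalgebra of [K (x) O(G)], generated by the coefficients of the
    element of [G] that carries [x] to the universal point
    ([descended_algebra]).  The heap theorem gives a point of this functor over
    [k], that is a point of [X (K)] with equal images under any two maps out of
    [K].  It lies in an affine open subscheme, hence comes from [X (k)]
    ([scheme_field_descent]). *)

Set Implicit Arguments.
Unset Strict Implicit.
Unset Printing Implicit Defensive.

Import GRing.Theory.
Local Open Scope ring_scope.

(** * Rings and homomorphisms from explicit data *)

Section SetoidRing.
Local Open Scope quotient_scope.
Variables (T : choiceType) (e : T -> T -> Prop).
Variables (zero one : T) (opp : T -> T) (add mul : T -> T -> T).
Hypothesis e_refl : forall x, e x x.
Hypothesis e_sym : forall x y, e x y -> e y x.
Hypothesis e_trans : forall y x z, e x y -> e y z -> e x z.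
Hypothesis opp_compat : forall x x', e x x' -> e (opp x) (opp x').
Hypothesis add_compat : forall x x' y y', e x x' -> e y y' -> e (add x y) (add x' y').
Hypothesis mul_compat : forall x x' y y', e x x' -> e y y' -> e (mul x y) (mul x' y').
Hypothesis addA : forall x y z, e (add x (add y z)) (add (add x y) z).
Hypothesis addC : forall x y, e (add x y) (add y x).
Hypothesis add0 : forall x, e (add zero x) x.
Hypothesis addN : forall x, e (add (opp x) x) zero.
Hypothesis mulA : forall x y z, e (mul x (mul y z)) (mul (mul x y) z).
Hypothesis mulC : forall x y, e (mul x y) (mul y x).
Hypothesis mul1 : forall x, e (mul one x) x.
Hypothesis mulDl : forall x y z, e (mul (add x y) z) (add (mul x z) (mul y z)).

Let r (x y : T) : bool := `[< e x y >].
Let r_refl : reflexive r. Proof. by move=> x; apply/asboolP. Qed.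
Let r_sym : symmetric r.
Proof. by move=> x y; apply/asboolP/asboolP; apply: e_sym. Qed.
Let r_trans : transitive r.
Proof. by move=> y x z /asboolP xy /asboolP yz; apply/asboolP/(e_trans xy). Qed.
Let er := EquivRel r r_refl r_sym r_trans.
Let Q : choiceType := {eq_quot er}.
Let pi (x : T) : Q := \pi_{eq_quot er} x.
Let rp (q : Q) : T := repr (q : {eq_quot er}).
Let rpK q : pi (rp q) = q. Proof. exact: reprK. Qed.
Let piP x y : pi x = pi y <-> e x y.
Proof.
split=> [/eqP|xy]; first by rewrite eqmodE => /asboolP.
by apply/eqP; rewrite eqmodE; apply/asboolP.
Qed.
Let eK x : e (rp (pi x)) x. Proof. by apply/piP; rewrite rpK. Qed.

Let qadd p q := pi (add (rp p) (rp q)).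
Let qopp p := pi (opp (rp p)).
Let qmul p q := pi (mul (rp p) (rp q)).
Let qaddE x y : qadd (pi x) (pi y) = pi (add x y).
Proof. by apply/piP/add_compat; apply: eK. Qed.
Let qoppE x : qopp (pi x) = pi (opp x).
Proof. by apply/piP/opp_compat; apply: eK. Qed.
Let qmulE x y : qmul (pi x) (pi y) = pi (mul x y).
Proof. by apply/piP/mul_compat; apply: eK. Qed.
Let qaddA : associative qadd.
Proof.
by move=> p q s; rewrite -(rpK p) -(rpK q) -(rpK s) !qaddE; apply/piP.
Qed.
Let qaddC : commutative qadd.
Proof. by move=> p q; apply/piP. Qed.
Let qadd0 : left_id (pi zero) qadd.
Proof. by move=> p; rewrite -(rpK p) qaddE; apply/piP. Qed.
Let qaddN : left_inverse (pi zero) qopp qadd.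
Proof. by move=> p; rewrite -(rpK p) qoppE qaddE; apply/piP. Qed.
Let qmulA : associative qmul.
Proof.
by move=> p q s; rewrite -(rpK p) -(rpK q) -(rpK s) !qmulE; apply/piP.
Qed.
Let qmulC : commutative qmul.
Proof. by move=> p q; apply/piP. Qed.
Let qmul1 : left_id (pi one) qmul.
Proof. by move=> p; rewrite -(rpK p) qmulE; apply/piP. Qed.
Let qmulDl : left_distributive qmul qadd.
Proof.
by move=> p q s; rewrite -(rpK p) -(rpK q) -(rpK s) ?(qaddE, qmulE); apply/piP.
Qed.

Let zQ := HB.pack_for zmodType Q
  (GRing.isZmodule.Build Q qaddA qaddC qadd0 qaddN).
Let rQ := HB.pack_for comPzRingType zQ
  (GRing.Zmodule_isComPzRing.Build zQ qmulA qmulC qmul1 qmulDl).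

(** A commutative ring may be presented by a carrier on which the axioms hold
    only up to an equivalence [e]; tensor products and residue rings are both
    obtained this way. *)
Lemma setoid_ring : exists (R : comPzRingType) (p : T -> R),
  [/\ forall x y, p x = p y <-> e x y, forall q, exists x, q = p x,
      p one = 1, forall x y, p (add x y) = p x + p y &
      forall x y, p (mul x y) = p x * p y].
Proof.
exists rQ, pi; split.
- exact: piP.
- by move=> q; exists (rp q); rewrite rpK.
- by [].
- by move=> x y; rewrite -qaddE.
- by move=> x y; rewrite -qmulE.
Qed.

End SetoidRing.

Lemma rmorph_exists (R S : pzRingType) (f : R -> S) :
  f 1 = 1 -> (forall x y, f (x + y) = f x + f y) ->
  (forall x y, f (x * y) = f x * f y) ->
  exists g : {rmorphism R -> S}, f =1 g.
Proof.
move=> f1 fD fM.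
have f_zm : zmod_morphism f.
  by move=> x y; apply: (addIr (f y)); rewrite -fD !subrK.
by exists (HB.pack_for {rmorphism R -> S} f
  (GRing.isZmodMorphism.Build R S f f_zm)
  (GRing.isMonoidMorphism.Build R S f (f1, fM))).
Qed.

Section Khom.
Variable k : fieldType.
Implicit Types A B C T : kalg k.

Lemma khom_exists A B (f : A -> B) :
  f 1 = 1 -> (forall x y, f (x + y) = f x + f y) ->
  (forall x y, f (x * y) = f x * f y) ->
  (forall c, f (kalg_str A c) = kalg_str B c) ->
  exists g : khom A B, f =1 g.
Proof.
move=> f1 fD fM fc; have [g gE] := rmorph_exists f1 fD fM.
have gc c : g (kalg_str A c) = kalg_str B c by rewrite -gE fc.
by exists (KHom gc).
Qed.

Lemma khom_congr A B (f g : khom A B) a : f = g -> f a = g a.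
Proof. by move=> ->. Qed.

Lemma khom_compA A B C T (h : khom C T) (g : khom B C) (f : khom A B) :
  khom_comp h (khom_comp g f) = khom_comp (khom_comp h g) f.
Proof. exact: khomP. Qed.

Lemma khom_comp_id_l A B (f : khom A B) : khom_comp (khom_id B) f = f.
Proof. exact: khomP. Qed.

Lemma khom_comp_id_r A B (f : khom A B) : khom_comp f (khom_id A) = f.
Proof. exact: khomP. Qed.

Lemma khom_inj A B (f : khom A B) : (forall x, f x = 0 -> x = 0) -> injective f.
Proof.
by move=> f0 x y /eqP; rewrite -subr_eq0 -rmorphB => /eqP/f0/subr0_eq.
Qed.

Lemma khom_comp_inj A B C (h : khom B C) (f g : khom A B) : injective h ->
  khom_comp h f = khom_comp h g -> f = g.
Proof.
by move=> hinj E; apply: khomP => a; apply: hinj; exact: (khom_congr a E).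
Qed.

Definition kstr A : khom (kalg_base k) A :=
  @KHom k (kalg_base k) A (kalg_str A) (fun=> erefl).

Lemma khom_kstr A B (f : khom A B) : khom_comp f (kstr A) = kstr B.
Proof. by apply: khomP => c; rewrite /= khom_str. Qed.

Lemma kstr_inj A : (1 : A) <> 0 -> injective (kstr A).
Proof.
move=> A1; apply: khom_inj => c c0; apply/eqP/negP => /negP cN0; apply: A1.
by rewrite -(rmorph1 (kstr A)) -[1](mulVf cN0) rmorphM c0 mulr0.
Qed.

End Khom.
Arguments kstr {k A}.

(** * Zorn's lemma above a given set *)

(** The chains may be taken nonempty and above [V], so that [P] need not hold of
    the empty set. *)
Lemma Zorn_above (T : Type) (P : set (set T)) (V : set T) :
  P V ->
  (forall F : set (set T), (exists X, F X) -> (F `<=` P)%classic ->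
     (forall X, F X -> V `<=` X)%classic ->
     total_on F subset -> P (\bigcup_(X in F) X)%classic) ->
  exists A : set T, [/\ (V `<=` A)%classic, P A &
    forall B, (A `<=` B)%classic -> P B -> (B `<=` A)%classic].
Proof.
move=> PV Pchain.
have [|A [PA Amax]] := @Zorn_bigcup T (fun W => P (W `|` V)%classic).
  move=> F FP Ftot; have [[X0 FX0]|F0] := pselect (exists X, F X); last first.
    suff -> : ((\bigcup_(X in F) X) `|` V = V)%classic by [].
    apply/seteqP; split=> x; last by right.
    by case=> // -[X FX]; case: F0; exists X.
  suff -> : ((\bigcup_(X in F) X) `|` V =
      \bigcup_(X in [set (Y `|` V)%classic | Y in F]) X)%classic.
    apply: Pchain.
    - by exists (X0 `|` V)%classic, X0.
    - by move=> _ [X FX <-]; apply: FP.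
    - by move=> _ [X FX <-] x; right.
    - move=> _ _ [X FX <-] [Y FY <-]; have [XY|YX] := Ftot _ _ FX FY.
        by left; apply: setSU.
      by right; apply: setSU.
  apply/seteqP; split=> x.
    case=> [[X FX Xx]|Vx]; first by exists (X `|` V)%classic; [exists X|left].
    by exists (X0 `|` V)%classic; [exists X0|right].
  by case=> _ [X FX <-] [Xx|Vx]; [left; exists X|right].
exists (A `|` V)%classic; split; [by move=> x; right|exact: PA|].
move=> B AB PB; have VB : (V `<=` B)%classic by move=> x Vx; apply: AB; right.
have [//|nBA] := pselect (B `<=` A `|` V)%classic.
case: (Amax B); last by rewrite (setUidl VB).
split; first by move=> x Ax; apply: AB; left.
by move=> BA; apply: nBA => x /BA; left.
Qed.

(** * Tensor products over a field *)

Section TensorConstruction.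
Variables (k : fieldType) (A B : kalg k).

Definition balanced (M : zmodType) (phi : A -> B -> M) : Prop :=
  [/\ forall a a' b, phi (a + a') b = phi a b + phi a' b,
      forall a b b', phi a (b + b') = phi a b + phi a b' &
      forall c a b, phi (kalg_str A c * a) b = phi a (kalg_str B c * b)].

Let bsum (M : zmodType) (phi : A -> B -> M) (s : seq (A * B)) : M :=
  \sum_(p <- s) phi p.1 p.2.

(* Formal sums are identified when no balanced map tells them apart, so the
   universal property is built into the relation. *)
Let teq (s s' : seq (A * B)) : Prop :=
  forall (M : zmodType) (phi : A -> B -> M), balanced phi ->
    bsum phi s = bsum phi s'.
Let tmul (s s' : seq (A * B)) : seq (A * B) :=
  [seq (p.1 * q.1, p.2 * q.2) | p <- s, q <- s'].
Let topp (s : seq (A * B)) : seq (A * B) := [seq (- p.1, p.2) | p <- s].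

Let bsum_mul (M : zmodType) (phi : A -> B -> M) s s' :
  bsum phi (tmul s s') =
  \sum_(p <- s) \sum_(q <- s') phi (p.1 * q.1) (p.2 * q.2).
Proof. by rewrite /bsum big_allpairs_dep. Qed.

Let bsum_opp (M : zmodType) (phi : A -> B -> M) s : balanced phi ->
  bsum phi (topp s) = - bsum phi s.
Proof.
case=> phiD _ _; rewrite /bsum big_map -sumrN; apply: eq_bigr => p _ /=.
apply: (addIr (phi p.1 p.2)); rewrite -phiD !addNr.
by apply: (addIr (phi 0 p.2)); rewrite -phiD !add0r.
Qed.

Let bal_mul (M : zmodType) (phi : A -> B -> M) s : balanced phi ->
  balanced (fun a b => \sum_(q <- s) phi (a * q.1) (b * q.2)).
Proof.
case=> pD pD' pZ; split=> [a a' b|a b b'|c a b].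
- by rewrite -big_split; apply: eq_bigr => q _ /=; rewrite mulrDl pD.
- by rewrite -big_split; apply: eq_bigr => q _ /=; rewrite mulrDl pD'.
- by apply: eq_bigr => q _; rewrite -mulrA pZ mulrA.
Qed.

Let teq_mulC s s' : teq (tmul s s') (tmul s' s).
Proof.
move=> M phi _; rewrite !bsum_mul exchange_big; apply: eq_bigr => p _.
by apply: eq_bigr => q _; rewrite [p.1 * _]mulrC [p.2 * _]mulrC.
Qed.

Let teq_mull s s' u : teq s s' -> teq (tmul s u) (tmul s' u).
Proof.
move=> ss' M phi bphi; rewrite !bsum_mul.
exact: (ss' _ _ (bal_mul u bphi)).
Qed.

(** The second clause is the universal property among additive groups; a tensor
    product of algebras needs it for maps that are not ring homomorphisms, such
    as the contraction against a linear functional. *)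
Lemma tensor_exists : exists (T : kalg k) (i1 : khom A T) (i2 : khom B T),
  (forall t, exists s : seq (A * B), t = \sum_(p <- s) i1 p.1 * i2 p.2) /\
  (forall s : seq (A * B), \sum_(p <- s) i1 p.1 * i2 p.2 = 0 ->
     forall (M : zmodType) (phi : A -> B -> M), balanced phi ->
       \sum_(p <- s) phi p.1 p.2 = 0).
Proof.
have [||||||||||||||R [p [pE psurj p1 pD pM]]] := @setoid_ring _ teq
  [::] [:: (1, 1)] topp cat tmul.
- by [].
- by move=> s s' ss' M phi /ss' ->.
- by move=> s' s s'' ss' ss'' M phi bphi; rewrite ss' ?ss''.
- by move=> s s' ss' M phi bphi; rewrite !bsum_opp ?ss'.
- move=> s s' u u' ss' uu' M phi bphi; rewrite /bsum !big_cat /=.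
  by congr (_ + _); [apply: ss'|apply: uu'].
- move=> s s' u u' ss' uu' M phi bphi.
  rewrite (teq_mull u ss' bphi) (teq_mulC s' u bphi).
  by rewrite (teq_mull s' uu' bphi) (teq_mulC u' s' bphi).
- by move=> s s' s'' M phi _; rewrite catA.
- by move=> s s' M phi _; rewrite /bsum !big_cat /= addrC.
- by [].
- move=> s M phi bphi; rewrite {1}/bsum big_cat /=.
  by rewrite (bsum_opp _ bphi : \sum_(i <- _) _ = _) addNr /bsum big_nil.
- move=> s s' s'' M phi _; rewrite !bsum_mul /tmul big_allpairs_dep.
  apply: eq_bigr => u _; rewrite big_allpairs_dep.
  by apply: eq_bigr => v _; apply: eq_bigr => w _ /=; rewrite !mulrA.
- exact: teq_mulC.
- move=> s M phi _; rewrite bsum_mul big_seq1.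
  by apply: eq_bigr => u _; rewrite !mul1r.
- by move=> s s' s'' M phi _; rewrite /tmul allpairs_cat.
have pnil : p [::] = 0 by apply: (addIr (p [::])); rewrite -pD add0r.
have simp1 a b b' : p [:: (a, b + b')] = p [:: (a, b)] + p [:: (a, b')].
  rewrite -pD; apply/pE => M phi [_ pD' _].
  by rewrite /bsum /= !big_cons !big_nil /= !addr0 pD'.
have simp2 a a' b : p [:: (a + a', b)] = p [:: (a, b)] + p [:: (a', b)].
  rewrite -pD; apply/pE => M phi [pD' _ _].
  by rewrite /bsum /= !big_cons !big_nil /= !addr0 pD'.
have simp3 a a' b b' : p [:: (a * a', b * b')] = p [:: (a, b)] * p [:: (a', b')].
  by rewrite -pM.
have [|||st stE] := @rmorph_exists k R (fun c => p [:: (kalg_str A c, 1)]).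
- by rewrite rmorph1.
- by move=> x y; rewrite rmorphD simp2.
- by move=> x y; rewrite rmorphM -simp3 mulr1.
pose T := KAlg st.
have [||||i1 i1E] := @khom_exists k A T (fun a => p [:: (a, 1)]).
- exact: p1.
- by move=> x y; rewrite simp2.
- by move=> x y; rewrite -simp3 mulr1.
- by move=> c; rewrite [RHS]/= -stE.
have [||||i2 i2E] := @khom_exists k B T (fun b => p [:: (1, b)]).
- exact: p1.
- by move=> x y; rewrite simp1.
- by move=> x y; rewrite -simp3 mulr1.
- move=> c; rewrite [RHS]/= -stE; apply/pE => M phi [_ _ pZ].
  by rewrite /bsum !big_seq1 /= -[kalg_str A c]mulr1 pZ mulr1.
have psum s : p s = \sum_(u <- s) i1 u.1 * i2 u.2.
  elim: s => [|[a b] s IH]; first by rewrite big_nil.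
  rewrite big_cons -IH -i1E -i2E /= -simp3 mulr1 mul1r.
  by rewrite -pD.
exists T, i1, i2; split=> [t|s].
  by have [s ->] := psurj t; exists s.
rewrite -psum -pnil => /pE s0 M phi bphi.
by rewrite [LHS](s0 M phi bphi) /bsum big_nil.
Qed.

End TensorConstruction.

Section Tensor.
Variable k : fieldType.
Implicit Types A B C T : kalg k.

Lemma tens_data A B : {T : kalg k & {i1 : khom A T & {i2 : khom B T |
  (forall t, exists s : seq (A * B), t = \sum_(p <- s) i1 p.1 * i2 p.2) /\
  (forall s : seq (A * B), \sum_(p <- s) i1 p.1 * i2 p.2 = 0 ->
     forall (M : zmodType) (phi : A -> B -> M), balanced phi ->
       \sum_(p <- s) phi p.1 p.2 = 0)}}}.
Proof.
by have /cid[T /cid[i1 /cid[i2 H]]] := tensor_exists A B; exists T, i1, i2.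
Qed.

Definition tens A B : kalg k := tag (tens_data A B).
Definition in1 A B : khom A (tens A B) := tag (tagged (tens_data A B)).
Definition in2 A B : khom B (tens A B) := sval (tagged (tagged (tens_data A B))).
Arguments in1 {A B}.
Arguments in2 {A B}.

Lemma tens_sum A B (t : tens A B) :
  exists s : seq (A * B), t = \sum_(p <- s) in1 p.1 * in2 p.2.
Proof. exact: (proj1 (svalP (tagged (tagged (tens_data A B))))). Qed.

Lemma tens_zero A B (s : seq (A * B)) :
  \sum_(p <- s) (in1 p.1 * in2 p.2 : tens A B) = 0 ->
  forall (M : zmodType) (phi : A -> B -> M), balanced phi ->
    \sum_(p <- s) phi p.1 p.2 = 0.
Proof. exact: (proj2 (svalP (tagged (tagged (tens_data A B))))). Qed.

Lemma tens_lift A B (M : zmodType) (phi : A -> B -> M) : balanced phi ->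
  exists2 f : tens A B -> M, (forall x y, f (x + y) = f x + f y) &
    forall a b, f (in1 a * in2 b) = phi a b.
Proof.
move=> bphi; pose rep t := sval (cid (@tens_sum A B t)).
have repE t : t = \sum_(p <- rep t) in1 p.1 * in2 p.2 := svalP (cid (tens_sum t)).
pose f t := \sum_(p <- rep t) phi p.1 p.2.
have fE s t : t = \sum_(p <- s) in1 p.1 * in2 p.2 ->
    f t = \sum_(p <- s) phi p.1 p.2.
  move=> tE; pose s' := [seq (- p.1, p.2) | p <- s].
  have phiN a b : phi (- a) b = - phi a b.
    case: bphi => phiD _ _; apply: (addIr (phi a b)); rewrite -phiD !addNr.
    by apply: (addIr (phi 0 b)); rewrite -phiD !add0r.
  have := @tens_zero A B (rep t ++ s'); rewrite big_cat -repE big_map /=.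
  under eq_bigr do rewrite rmorphN mulNr.
  rewrite sumrN -tE subrr => /(_ erefl _ _ bphi).
  rewrite big_cat big_map /=; under [X in _ + X]eq_bigr do rewrite phiN.
  by rewrite sumrN => /subr0_eq.
exists f => [x y|a b]; last first.
  by rewrite (fE [:: (a, b)]) !big_seq1.
rewrite (fE (rep x ++ rep y)) ?big_cat //=.
by rewrite -!repE.
Qed.

Lemma tens_ind A B (P : tens A B -> Prop) :
  P 0 -> (forall x y, P x -> P y -> P (x + y)) ->
  (forall a b, P (in1 a * in2 b)) -> forall t, P t.
Proof.
move=> P0 PD Pab t; have [s ->] := tens_sum t.
by elim: s => [|p s IH]; rewrite ?big_nil // big_cons; apply: PD.
Qed.

Lemma tpair_ex A B C (u : khom A C) (v : khom B C) :
  exists g : khom (tens A B) C, forall a b, g (in1 a * in2 b) = u a * v b.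
Proof.
have [|f fD fE] := @tens_lift A B C (fun a b => u a * v b).
  split=> [a a' b|a b b'|c a b].
  - by rewrite rmorphD mulrDl.
  - by rewrite rmorphD mulrDr.
  - by rewrite !rmorphM !khom_str mulrCA mulrA.
have f0 : f 0 = 0 by apply: (addIr (f 0)); rewrite -fD !add0r.
have [||||g gE] := @khom_exists k (tens A B) C f.
- by rewrite -[1]mulr1 -{1}[1](rmorph1 in1) -(rmorph1 in2) fE !rmorph1 mulr1.
- exact: fD.
- move=> x y; elim/tens_ind: x => [|x x' IH IH'|a b].
  + by rewrite !(mul0r, f0).
  + by rewrite mulrDl !fD IH IH' mulrDl.
  + elim/tens_ind: y => [|y y' IH IH'|a' b'].
    * by rewrite !(mulr0, f0).
    * by rewrite mulrDr !fD IH IH' mulrDr.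
    * by rewrite mulrACA -!rmorphM !fE !rmorphM mulrACA.
- move=> c; rewrite -(khom_str (@in1 A B)) -[X in f X]mulr1 -(rmorph1 in2) fE.
  by rewrite rmorph1 mulr1 khom_str.
by exists g => a b; rewrite -gE.
Qed.

Definition tpair A B C (u : khom A C) (v : khom B C) : khom (tens A B) C :=
  sval (cid (tpair_ex u v)).

Lemma tpairE A B C (u : khom A C) (v : khom B C) a b :
  tpair u v (in1 a * in2 b) = u a * v b.
Proof. exact: (svalP (cid (tpair_ex u v))). Qed.

Lemma tpair1 A B C (u : khom A C) (v : khom B C) a : tpair u v (in1 a) = u a.
Proof. by rewrite -[in1 a]mulr1 -(rmorph1 in2) tpairE rmorph1 mulr1. Qed.

Lemma tpair2 A B C (u : khom A C) (v : khom B C) b : tpair u v (in2 b) = v b.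
Proof. by rewrite -[in2 b]mul1r -(rmorph1 in1) tpairE rmorph1 mul1r. Qed.

Lemma tpair_in1 A B C (u : khom A C) (v : khom B C) :
  khom_comp (tpair u v) in1 = u.
Proof. by apply: khomP => a; rewrite /= tpair1. Qed.

Lemma tpair_in2 A B C (u : khom A C) (v : khom B C) :
  khom_comp (tpair u v) in2 = v.
Proof. by apply: khomP => a; rewrite /= tpair2. Qed.

Lemma tens_ext A B C (f g : khom (tens A B) C) :
  khom_comp f in1 = khom_comp g in1 -> khom_comp f in2 = khom_comp g in2 ->
  f = g.
Proof.
move=> e1 e2; apply: khomP; elim/tens_ind => [|x y IHx IHy|a b].
- by rewrite !rmorph0.
- by rewrite !rmorphD IHx IHy.
- rewrite !rmorphM.
  have := congr1 (fun h : khom A C => h a) e1.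
  by have := congr1 (fun h : khom B C => h b) e2; rewrite /= => -> ->.
Qed.

Lemma tpair_comp A B C T (g : khom C T) (u : khom A C) (v : khom B C) :
  khom_comp g (tpair u v) = tpair (khom_comp g u) (khom_comp g v).
Proof. by apply: tens_ext; rewrite -khom_compA ?tpair_in1 ?tpair_in2. Qed.

Definition tmap A B A' B' (u : khom A A') (v : khom B B') :
  khom (tens A B) (tens A' B') := tpair (khom_comp in1 u) (khom_comp in2 v).

Definition tswap A B : khom (tens A B) (tens B A) := tpair in2 in1.

(** * Linear functionals and slices *)

Definition klin A (lam : A -> k) : Prop :=
  (forall x y, lam (x + y) = lam x + lam y) /\
  (forall c x, lam (kalg_str A c * x) = c * lam x).

Definition ksubspace A (V : set A) : Prop :=
  V 0 /\ forall c x y, V x -> V y -> V (kalg_str A c * x + y).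

(** A subspace maximal among those that contain [V] and avoid [b] is a
    hyperplane complementary to the line of [b]; the functional is the
    coordinate along [b]. *)
Lemma separating_functional A (V : set A) (b : A) : ksubspace V -> ~ V b ->
  exists lam : A -> k, [/\ klin lam, forall x, V x -> lam x = 0 & lam b = 1].
Proof.
move=> Vsub nVb.
have [||W [VW [Wsub nWb] Wmax]] :=
  @Zorn_above A (fun W => ksubspace W /\ ~ W b) V.
- by [].
- move=> F [X0 FX0] FP VF Ftot; split; last by case=> X /FP[_ nXb].
  split; first by exists X0 => //; case: (FP _ FX0) => -[].
  move=> c x y [X FX Xx] [Y FY Yy]; have [XY|YX] := Ftot _ _ FX FY.
    by exists Y => //; case: (FP _ FY) => -[_ Yl] _; apply: Yl => //; apply: XY.
  by exists X => //; case: (FP _ FX) => -[_ Xl] _; apply: Xl => //; apply: YX.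
have [W0 Wl] := Wsub.
have WD x y : W x -> W y -> W (x + y).
  by move=> Wx Wy; rewrite -[x]mul1r -(rmorph1 (kalg_str A)); apply: Wl.
have WZ c x : W x -> W (kalg_str A c * x).
  by move=> Wx; rewrite -[_ * _]addr0; apply: Wl.
have WN x : W x -> W (- x).
  by move=> Wx; rewrite -mulN1r -(rmorph1 (kalg_str A)) -rmorphN; apply: WZ.
have dec u : exists c, W (u - kalg_str A c * b).
  have [Wu|nWu] := pselect (W u).
    by exists 0; rewrite rmorph0 mul0r subr0.
  pose W' : set A := fun x => exists d, W (x - kalg_str A d * u).
  have WW' : (W `<=` W')%classic.
    by move=> x Wx; exists 0; rewrite rmorph0 mul0r subr0.
  have W'sub : ksubspace W'.
    split; first exact: WW'.
    move=> c x y [d Wd] [d' Wd']; exists (c * d + d').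
    rewrite (_ : _ - _ = kalg_str A c * (x - kalg_str A d * u) +
      (y - kalg_str A d' * u)); first exact: Wl.
    by rewrite rmorphD rmorphM mulrBr mulrDl mulrA opprD addrACA.
  have [[d Wd]|nW'b] := pselect (W' b); last first.
    case: nWu; apply: (Wmax W' WW' (conj W'sub nW'b)).
    by exists 1; rewrite rmorph1 mul1r subrr.
  have [d0|dN0] := eqVneq d 0.
    by case: nWb; rewrite d0 rmorph0 mul0r subr0 in Wd.
  exists d^-1; rewrite (_ : _ - _ = - (kalg_str A d^-1 * (b - kalg_str A d * u))).
    exact/WN/WZ.
  by rewrite mulrBr mulrA -rmorphM mulVf // rmorph1 mul1r opprB.
have uniq u c c' : W (u - kalg_str A c * b) -> W (u - kalg_str A c' * b) -> c = c'.
  move=> Wc Wc'; apply/eqP; rewrite -subr_eq0; apply/negP => cc'.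
  case: nWb; rewrite (_ : b = kalg_str A (c - c')^-1 *
      ((u - kalg_str A c' * b) - (u - kalg_str A c * b))).
    by apply/WZ/WD => //; apply: WN.
  rewrite opprB [u - _ + _]addrC addrA subrK -mulrBl -rmorphB mulrA -rmorphM mulVf.
    by rewrite rmorph1 mul1r.
  exact/negP.
pose lam u := sval (cid (dec u)).
have lamW u : W (u - kalg_str A (lam u) * b) := svalP (cid (dec u)).
exists lam; split.
- split=> [x y|c x]; apply: (uniq _ _ _ (lamW _)).
    by rewrite rmorphD mulrDl opprD addrACA; apply: WD.
  by rewrite rmorphM -mulrA -mulrBr; apply: WZ.
- move=> x Vx; apply: (uniq _ _ _ (lamW x)).
  by rewrite rmorph0 mul0r subr0; apply: VW.
- by apply: (uniq _ _ _ (lamW b)); rewrite rmorph1 mul1r subrr.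
Qed.

Definition indep A n (v : 'I_n -> A) : Prop :=
  forall c : 'I_n -> k, \sum_i kalg_str A (c i) * v i = 0 -> forall i, c i = 0.

Lemma indep_dual A n (v : 'I_n -> A) (j : 'I_n) : indep v ->
  exists2 lam : A -> k, klin lam & forall i, lam (v i) = (i == j)%:R.
Proof.
move=> vind.
pose V : set A := fun x => exists2 c : 'I_n -> k, c j = 0 &
  x = \sum_i kalg_str A (c i) * v i.
have [||lam [llam lamV lamj]] := @separating_functional A V (v j).
- split.
    exists (fun=> 0) => //.
    by rewrite big1 // => i _; rewrite rmorph0 mul0r.
  move=> d _ _ [c cj ->] [c' c'j ->]; exists (fun i => d * c i + c' i).
    by rewrite cj c'j mulr0 addr0.
  rewrite mulr_sumr -big_split; apply: eq_bigr => i _ /=.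
  by rewrite mulrA -rmorphM -mulrDl -rmorphD.
- case=> c cj vj; pose d i := c i - (i == j)%:R.
  have /vind/(_ j)/eqP : \sum_i kalg_str A (d i) * v i = 0.
    under eq_bigr do rewrite rmorphB mulrBl.
    rewrite big_split /= -vj sumrN (bigD1 j) //= eqxx rmorph1 mul1r.
    rewrite big1 ?addr0 ?subrr // => i /negPf ->.
    by rewrite rmorph0 mul0r.
  by rewrite /d cj eqxx sub0r oppr_eq0 oner_eq0.
exists lam => // i; have [->//|ij] := eqVneq i j.
apply: lamV; exists (fun l => (l == i)%:R); first by rewrite eq_sym (negPf ij).
rewrite (bigD1 i) //= eqxx rmorph1 mul1r big1 ?addr0 // => l /negPf ->.
by rewrite rmorph0 mul0r.
Qed.

Lemma indep1 A : (1 : A) <> 0 -> indep (fun _ : 'I_1 => 1 : A).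
Proof.
move=> A1 c; rewrite big_ord1 mulr1 => c0 i; rewrite ord1.
apply/eqP/negP => /negP cN0; apply: A1.
by rewrite -(rmorph1 (kalg_str A)) -(mulVf cN0) rmorphM c0 mulr0.
Qed.

Lemma slice_ex A B (lam : A -> k) : klin lam ->
  exists2 f : tens A B -> B, (forall x y, f (x + y) = f x + f y) &
    forall a b, f (in1 a * in2 b) = kalg_str B (lam a) * b.
Proof.
case=> lD lZ; apply: tens_lift; split=> [a a' b|a b b'|c a b].
- by rewrite lD rmorphD mulrDl.
- by rewrite mulrDr.
- by rewrite lZ rmorphM mulrCA mulrA.
Qed.

(** The contraction [lam (x) id]: it reads off the coefficients of a tensor in
    its second factor. *)
Definition slice A B (lam : A -> k) (llam : klin lam) : tens A B -> B :=
  s2val (cid2 (@slice_ex A B _ llam)).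

Lemma sliceD A B (lam : A -> k) (llam : klin lam) (x y : tens A B) :
  slice llam (x + y) = slice llam x + slice llam y.
Proof. by move: x y; exact: (s2valP (cid2 (@slice_ex A B _ llam))). Qed.

Lemma sliceE A B (lam : A -> k) (llam : klin lam) a (b : B) :
  slice llam (in1 a * in2 b) = kalg_str B (lam a) * b.
Proof. by move: a b; exact: (s2valP' (cid2 (@slice_ex A B _ llam))). Qed.

Lemma slice0 A B (lam : A -> k) (llam : klin lam) :
  slice llam (0 : tens A B) = 0.
Proof. by apply: (addIr (slice llam 0)); rewrite -sliceD !add0r. Qed.

Lemma slice_sum A B (lam : A -> k) (llam : klin lam) (I : Type) (r : seq I) F :
  slice llam (\sum_(i <- r) F i : tens A B) = \sum_(i <- r) slice llam (F i).
Proof.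
elim/big_rec2: _ => [|i y1 y2 _ <-]; [exact: slice0|exact: sliceD].
Qed.

Lemma slice_natural A B C (g : khom B C) (lam : A -> k) (llam : klin lam)
  (t : tens A B) : slice llam (tpair in1 (khom_comp in2 g) t) = g (slice llam t).
Proof.
elim/tens_ind: t => [|x y IHx IHy|a b].
- by rewrite rmorph0 !slice0 rmorph0.
- by rewrite rmorphD !sliceD rmorphD IHx IHy.
- by rewrite tpairE !sliceE rmorphM khom_str.
Qed.

Lemma slice_in2 A B (lam : A -> k) (llam : klin lam) b (t : tens A B) :
  slice llam (in2 b * t) = b * slice llam t.
Proof.
elim/tens_ind: t => [|x y IHx IHy|a b'].
- by rewrite mulr0 slice0 mulr0.
- by rewrite mulrDr !sliceD IHx IHy mulrDr.
- by rewrite mulrCA -rmorphM !sliceE mulrCA.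
Qed.

Lemma slice_dual A B n (a : 'I_n -> A) (b : 'I_n -> B) i (lam : A -> k)
    (llam : klin lam) : (forall j, lam (a j) = (j == i)%:R) ->
  slice llam (\sum_j in1 (a j) * in2 (b j)) = b i.
Proof.
move=> lamE; rewrite slice_sum (bigD1 i) //= sliceE lamE eqxx rmorph1 mul1r.
rewrite big1 ?addr0 // => j ji.
by rewrite sliceE lamE (negPf ji) rmorph0 mul0r.
Qed.

Lemma tswap_sum A B n (a : 'I_n -> A) (b : 'I_n -> B) :
  tswap A B (\sum_i in1 (a i) * in2 (b i)) = \sum_i in1 (b i) * in2 (a i).
Proof. by rewrite rmorph_sum; apply: eq_bigr => i _; rewrite tpairE mulrC. Qed.

Lemma tens_sum0_indepl A B n (a : 'I_n -> A) (b : 'I_n -> B) : indep a ->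
  \sum_i (in1 (a i) * in2 (b i) : tens A B) = 0 -> forall i, b i = 0.
Proof.
move=> aind E i; have [lam llam lamE] := indep_dual i aind.
by rewrite -(slice_dual b llam lamE) E slice0.
Qed.

Lemma tens_sum0_indepr A B n (a : 'I_n -> A) (b : 'I_n -> B) : indep b ->
  \sum_i (in1 (a i) * in2 (b i) : tens A B) = 0 -> forall i, a i = 0.
Proof.
move=> bind E; apply: (@tens_sum0_indepl B A n b a bind).
by rewrite -tswap_sum E rmorph0.
Qed.

Lemma tens_sum_inj_indepl A B n (a : 'I_n -> A) (x y : 'I_n -> B) : indep a ->
  \sum_i (in1 (a i) * in2 (x i) : tens A B) = \sum_i in1 (a i) * in2 (y i) ->
  x =1 y.
Proof.
move=> aind E i; apply/subr0_eq.
apply: (@tens_sum0_indepl A B n a (fun i => x i - y i) aind).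
under eq_bigr do rewrite rmorphB mulrBr.
by rewrite sumrB E subrr.
Qed.

(** A decomposition of minimal length has independent entries on both sides: a
    linear relation on either side would let one term be absorbed by the
    others. *)
Lemma tens_indep A B (t : tens A B) : exists n (a : 'I_n -> A) (b : 'I_n -> B),
  [/\ indep a, indep b & t = \sum_i in1 (a i) * in2 (b i)].
Proof.
pose P n := `[< exists (a : 'I_n -> A) (b : 'I_n -> B),
                 t = \sum_i in1 (a i) * in2 (b i) >].
have exP : exists n, P n.
  have [s tE] := tens_sum t; exists (size s); apply/asboolP.
  exists (fun i => (nth 0 s i).1), (fun i => (nth 0 s i).2).
  by rewrite tE (big_nth 0) big_mkord.
case: (ex_minnP exP) => n /asboolP[a [b tE]] nmin.
have red (c : 'I_n -> k) (j : 'I_n) (C : kalg k) (v : 'I_n -> C) :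
    \sum_i kalg_str C (c i) * v i = 0 -> c j != 0 ->
    v j = \sum_(i | i != j) kalg_str C (- (c j)^-1 * c i) * v i.
  move=> E cj.
  under eq_bigr do rewrite rmorphM -mulrA.
  rewrite -mulr_sumr; have := E; rewrite (bigD1 j) //= => /eqP.
  rewrite addrC addr_eq0 => /eqP ->.
  by rewrite rmorphN mulNr mulrN opprK mulrA -rmorphM mulVf // rmorph1 mul1r.
have short (x : 'I_n -> A) (y : 'I_n -> B) (j : 'I_n) :
    t = \sum_(i | i != j) in1 (x i) * in2 (y i) -> False.
  move=> E; suff /nmin : P n.-1 by rewrite leqNgt prednK ?leqnn //; apply: leq_trans (ltn_ord j).
  apply/asboolP; exists (x \o lift j), (y \o lift j); rewrite E.
  pose F i : tens A B := in1 (x i) * in2 (y i).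
  have := bigD1_ord j isT : \sum_i F i = _.
  by rewrite (bigD1 j) //= => /addrI.
exists n, a, b; split=> //.
- move=> c E j; apply/eqP; case: eqP => // /eqP cj.
  pose d i := - (c j)^-1 * c i.
  case: (@short a (fun i => b i + kalg_str B (d i) * b j) j).
  rewrite tE (bigD1 j) //= [in X in X + _](red c j _ _ E cj) rmorph_sum.
  rewrite mulr_suml -big_split; apply: eq_bigr => i _ /=.
  rewrite -/(d i) rmorphD mulrDr addrC [in1 (_ * _)]rmorphM [in2 (_ * _)]rmorphM.
  by rewrite !khom_str mulrCA mulrA.
- move=> c E j; apply/eqP; case: eqP => // /eqP cj.
  pose d i := - (c j)^-1 * c i.
  case: (@short (fun i => a i + kalg_str A (d i) * a j) b j).
  rewrite tE (bigD1 j) //= [in X in X + _](red c j _ _ E cj) rmorph_sum.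
  rewrite mulr_sumr -big_split; apply: eq_bigr => i _ /=.
  rewrite -/(d i) rmorphD mulrDl addrC [in1 (_ * _)]rmorphM [in2 (_ * _)]rmorphM.
  by rewrite !khom_str mulrCA mulrA.
Qed.
Lemma tens_slices A B (t : tens A B) : exists s : seq (A * B),
  t = \sum_(p <- s) in1 p.1 * in2 p.2 /\
  forall p, p \in s ->
    (exists (lam : A -> k) (llam : klin lam), p.2 = slice llam t) /\
    (exists (lam : B -> k) (llam : klin lam), p.1 = slice llam (tswap A B t)).
Proof.
have [n [a [b [aind bind ->]]]] := tens_indep t.
exists [seq (a i, b i) | i <- index_enum 'I_n]; split; first by rewrite big_map.
move=> _ /mapP[i _ ->] /=; split.
  have [lam llam lamE] := indep_dual i aind; exists lam, llam.
  by rewrite (slice_dual b llam lamE).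
have [lam llam lamE] := indep_dual i bind; exists lam, llam.
by rewrite tswap_sum (slice_dual a llam lamE).
Qed.

Lemma indep_inj A B (f : khom A B) n (v : 'I_n -> A) : injective f ->
  indep v -> indep (fun i => f (v i)).
Proof.
move=> finj vind c E; apply: vind; apply: finj; rewrite rmorph0 -[RHS]E rmorph_sum.
by apply: eq_bigr => i _; rewrite rmorphM khom_str.
Qed.

(** Over a field every module is flat, so [u (x) id] and [id (x) v] are injective. *)
Lemma tmap_inj A B A' B' (u : khom A A') (v : khom B B') :
  injective u -> injective v -> injective (tmap u v).
Proof.
move=> uinj vinj; apply: khom_inj => t.
have [n [a [b [_ bind ->]]]] := tens_indep t.
rewrite rmorph_sum; under eq_bigr do rewrite tpairE.
move=> /(tens_sum0_indepr (indep_inj vinj bind)) a0; rewrite big1 // => i _.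
by rewrite (uinj (a i) 0) ?rmorph0 ?mul0r ?a0.
Qed.

Lemma in1_inj A B : (1 : B) <> 0 -> injective (@in1 A B).
Proof.
move=> B1; apply: khom_inj => a a0.
have := @tens_sum0_indepr A B 1 (fun=> a) _ (indep1 B1).
by rewrite big_ord1 rmorph1 mulr1 => /(_ a0 ord0).
Qed.

Lemma in2_inj A B : (1 : A) <> 0 -> injective (@in2 A B).
Proof.
move=> A1; apply: khom_inj => b b0.
have := @tens_sum0_indepl A B 1 _ (fun=> b) (indep1 A1).
by rewrite big_ord1 rmorph1 mul1r => /(_ b0 ord0).
Qed.

Lemma tens_nonzero A B : (1 : A) <> 0 -> (1 : B) <> 0 -> (1 : tens A B) <> 0.
Proof. by move=> A1 B1; rewrite -(rmorph1 in1) -(rmorph0 in1) => /(in1_inj B1). Qed.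

(** Descent of elements along [k -> A]: the two maps from [A] to [A (x) A] agree
    only on scalars. *)
Lemma in1_eq_in2_scalar A (z : A) : (1 : A) <> 0 ->
  in1 z = in2 z :> tens A A -> exists c, z = kalg_str A c.
Proof.
move=> A1 E; have [lam llam lamE] := indep_dual ord0 (indep1 A1).
have e1 : slice llam (in1 z : tens A A) = kalg_str A (lam z).
  by rewrite -[in1 z]mulr1 -(rmorph1 in2) sliceE mulr1.
have e2 : slice llam (in2 z : tens A A) = z.
  by rewrite -[in2 z]mul1r -(rmorph1 in1) sliceE (lamE ord0) rmorph1 mul1r.
by exists (lam z); rewrite -e1 E e2.
Qed.

Definition tmapr A B C (g : khom B C) : khom (tens A B) (tens A C) :=
  tpair in1 (khom_comp in2 g).

Lemma tmapr_inj A B C (g : khom B C) : injective g -> injective (tmapr A g).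
Proof.
move=> ginj; rewrite (_ : tmapr A g = tmap (khom_id A) g).
  by apply: tmap_inj => //; apply: inj_id.
by congr tpair; apply: khomP.
Qed.

Lemma tmapr_in1 A B C (g : khom B C) : khom_comp (tmapr A g) in1 = in1.
Proof. exact: tpair_in1. Qed.

Lemma tmapr_in2 A B C (g : khom B C) :
  khom_comp (tmapr A g) in2 = khom_comp in2 g.
Proof. exact: tpair_in2. Qed.

Lemma tmapr_comp A B C T (f : khom C T) (g : khom B C) :
  khom_comp (tmapr A f) (tmapr A g) = tmapr A (khom_comp f g).
Proof. by rewrite {2}/tmapr tpair_comp tmapr_in1 khom_compA tmapr_in2 -khom_compA. Qed.

Lemma tpair_tmapr A B C T (u : khom A T) (f : khom C T) (g : khom B C) :
  khom_comp (tpair u f) (tmapr A g) = tpair u (khom_comp f g).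
Proof. by rewrite tpair_comp tpair_in1 khom_compA tpair_in2. Qed.

End Tensor.
Arguments in1 {k A B}.
Arguments in2 {k A B}.

(** * Ideals, quotients and points in fields *)

Section Ideals.

Definition ideal (R : comPzRingType) (J : set R) : Prop :=
  [/\ J 0, forall x y, J x -> J y -> J (x + y) & forall a x, J x -> J (a * x)].

Definition multiplicative_set (R : comPzRingType) (S : set R) : Prop :=
  S 1 /\ forall x y, S x -> S y -> S (x * y).

(** An ideal maximal among those disjoint from [S] is prime: if neither factor of
    a product lies in it, enlarging it by either factor produces an element of
    [S], and the product of these two elements lies in both sets. *)
Lemma prime_avoiding (R : comPzRingType) (J S : set R) :
  ideal J -> multiplicative_set S -> (forall x, J x -> ~ S x) ->
  exists P : set R, [/\ ideal P, (J `<=` P)%classic, forall x, P x -> ~ S x &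
    forall x y, P (x * y) -> P x \/ P y].
Proof.
move=> Jid [S1 SM] JS.
have [||P [JP [Pid PS] Pmax]] :=
  @Zorn_above R (fun I => ideal I /\ forall x, I x -> ~ S x) J.
- by [].
- move=> F [X0 FX0] FP _ Ftot; split; last by move=> x [X /FP[_ XS] /XS].
  split.
  + by exists X0 => //; case: (FP _ FX0) => -[].
  + move=> x y [X FX Xx] [Y FY Yy]; have [XY|YX] := Ftot _ _ FX FY.
      by exists Y => //; case: (FP _ FY) => -[_ YD _] _; apply: YD => //; apply: XY.
    by exists X => //; case: (FP _ FX) => -[_ XD _] _; apply: XD => //; apply: YX.
  + by move=> a x [X FX Xx]; exists X => //; case: (FP _ FX) => -[_ _ XM] _; apply: XM.
have [P0 PD PM] := Pid.
exists P; split=> // x y Pxy.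
have grow z : ~ P z -> exists2 s, S s & exists p a, P p /\ s = p + a * z.
  move=> nPz; pose I : set R := fun s => exists p a, P p /\ s = p + a * z.
  have PI : (P `<=` I)%classic by move=> p Pp; exists p, 0; rewrite mul0r addr0.
  apply: contrapT => H; apply: nPz; apply: (Pmax I PI); last first.
    by exists 0, 1; rewrite mul1r add0r.
  split; last by move=> s Is Ss; apply: H; exists s.
  split; first exact: PI.
  + move=> _ _ [p [a [Pp ->]]] [p' [a' [Pp' ->]]]; exists (p + p'), (a + a').
    by split; [apply: PD|rewrite mulrDl addrACA].
  + move=> b _ [p [a [Pp ->]]]; exists (b * p), (b * a).
    by split; [apply: PM|rewrite mulrDr mulrA].
apply: contrapT => H.
have [|s Ss [p [a [Pp sE]]]] := grow x; first by move=> Px; apply: H; left.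
have [|s' Ss' [p' [a' [Pp' s'E]]]] := grow y; first by move=> Py; apply: H; right.
apply: (PS (s * s')); last exact: SM.
rewrite sE s'E mulrDl; apply: (PD); first by rewrite mulrC; apply: PM.
rewrite mulrDr; apply: PD; first exact: PM.
by rewrite mulrACA; apply: PM.
Qed.

Lemma fraction_quotient (D : idomainType) (x : {fraction D}) :
  exists n d : D, d != 0 /\ x * tofrac d = tofrac n.
Proof.
elim/quotW: x => x; exists x.1, x.2; split; first exact: denom_ratioP.
unlock tofrac; rewrite -[LHS]FracField.pi_mul; apply/eqmodP.
rewrite /= FracField.equivfE /FracField.mulf !numden_Ratio ?oner_eq0 //;
  rewrite ?mulr1 ?denom_ratioP //.
by rewrite mulrC.
Qed.

(** That every element is a fraction is what makes maps out of [K] definable, see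
    [fraction_lift]. *)
Lemma domain_fraction_field (R : comPzRingType) : (1 : R) <> 0 ->
  (forall x y : R, x * y = 0 -> x = 0 \/ y = 0) ->
  exists (K : fieldType) (f : {rmorphism R -> K}), injective f /\
    forall x : K, exists n d, f d <> 0 /\ x * f d = f n.
Proof.
move=> R1 Rdom.
have R1' : (1 : R) != 0 by apply/eqP.
pose nR := HB.pack_for comNzRingType R (GRing.PzSemiRing_isNonZero.Build R R1').
pose u : {pred nR} := fun x => `[< exists y, y * x = 1 >].
pose inv (x : nR) : nR := if pselect (exists y, y * x = 1) is left e
  then sval (cid e) else x.
have mulVx : {in u, left_inverse 1 inv *%R}.
  move=> x /asboolP xu; rewrite /inv; case: pselect => // e.
  exact: (svalP (cid e)).
have unitPl x y : y * x = 1 -> u x by move=> yx; apply/asboolP; exists y.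
have inv_out : {in [predC u], inv =1 id}.
  move=> x; rewrite inE /= => /asboolP xu; rewrite /inv.
  by case: pselect.
pose uR := HB.pack_for comUnitRingType nR
  (GRing.ComNzRing_hasMulInverse.Build nR mulVx unitPl inv_out).
have dom : GRing.integral_domain_axiom uR.
  by move=> x y /Rdom[->|->]; rewrite eqxx ?orbT.
pose dR := HB.pack_for idomainType uR (GRing.ComUnitRing_isIntegral.Build uR dom).
exists {fraction dR}, (@tofrac dR : {rmorphism dR -> {fraction dR}}).
split=> [x y /eqP|x]; first by rewrite (tofrac_eq (x : dR) (y : dR)) => /eqP.
have [n [d [dN0 xd]]] := fraction_quotient x; exists n, d; split=> //.
by apply/eqP; rewrite (tofrac_eq0 (d : dR)).
Qed.

Variable k : fieldType.
Implicit Types A B C T : kalg k.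

Lemma quotient_exists B (J : set B) : ideal J ->
  exists (Q : kalg k) (p : khom B Q), (forall x, p x = 0 <-> J x) /\
    forall q, exists x, q = p x.
Proof.
case=> J0 JD JM.
have JN x : J x -> J (- x) by move=> Jx; rewrite -mulN1r; apply: JM.
have [||||||||||||||R [p [pE psurj p1 pD pM]]] := @setoid_ring B
  (fun x y => J (x - y)) 0 1 -%R +%R *%R.
- by move=> x; rewrite subrr.
- by move=> x y /JN; rewrite opprB.
- by move=> y x z xy yz; rewrite -[x](subrK y) -addrA; apply: JD.
- by move=> x y /JN; rewrite opprB opprK addrC.
- by move=> x x' y y' xx' yy'; rewrite opprD addrACA; apply: JD.
- move=> x x' y y' xx' yy'; rewrite -[x * y](subrK (x' * y)) -addrA.
  by apply: JD; rewrite -?mulrBl -?mulrBr; [rewrite mulrC|]; apply: JM.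
- by move=> x y z; rewrite addrA subrr.
- by move=> x y; rewrite [x + y]addrC subrr.
- by move=> x; rewrite add0r subrr.
- by move=> x; rewrite addNr subrr.
- by move=> x y z; rewrite mulrA subrr.
- by move=> x y; rewrite [x * y]mulrC subrr.
- by move=> x; rewrite mul1r subrr.
- by move=> x y z; rewrite mulrDl subrr.
have [f fE] := rmorph_exists p1 pD pM.
pose st : {rmorphism k -> R} := f \o kalg_str B.
have [||||g gE] := @khom_exists k B (KAlg st) p.
- exact: p1.
- exact: pD.
- exact: pM.
- by move=> c; rewrite /= -fE.
exists (KAlg st), g; split=> [x|q].
  rewrite -gE -[in X in _ <-> X](subr0 x) -pE.
  suff -> : p 0 = 0 by [].
  by rewrite fE rmorph0.
by have [x ->] := psurj q; exists x; rewrite -gE.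
Qed.

Lemma surj_lift B Q C (p : khom B Q) (f : khom B C) :
  (forall q, exists x, q = p x) -> (forall x, p x = 0 -> f x = 0) ->
  exists g : khom Q C, khom_comp g p = f.
Proof.
move=> psurj pf; pose r q := sval (cid (psurj q)).
have rE q : q = p (r q) := svalP (cid (psurj q)).
have fr x : f (r (p x)) = f x.
  by apply/subr0_eq; rewrite -rmorphB; apply: pf; rewrite rmorphB -rE subrr.
have [||||g gE] := @khom_exists k Q C (fun q => f (r q)).
- by rewrite -(rmorph1 p) fr rmorph1.
- by move=> x y; rewrite [x]rE [y]rE -rmorphD !fr rmorphD.
- by move=> x y; rewrite [x]rE [y]rE -rmorphM !fr rmorphM.
- by move=> c; rewrite -(khom_str p) fr khom_str.
by exists g; apply: khomP => x; rewrite /= -gE fr.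
Qed.

(** The residue field at a prime that contains [J] and avoids [S]. *)
Lemma field_point B (J S : set B) :
  ideal J -> multiplicative_set S -> (forall x, J x -> ~ S x) ->
  exists (K : fieldType) (st : {rmorphism k -> K}) (f : khom B (KAlg st)),
    (forall x, J x -> f x = 0) /\ (forall x, S x -> f x <> 0).
Proof.
move=> Jid Smul JS.
have [P [Pid JP PS Pprime]] := prime_avoiding Jid Smul JS.
have [Q [p [pE psurj]]] := quotient_exists Pid.
have [||K [f [finj _]]] := @domain_fraction_field Q.
- by rewrite -(rmorph1 p) => /pE/PS; apply; case: Smul.
- move=> x y; have [{}x ->] := psurj x; have [{}y ->] := psurj y.
  by rewrite -rmorphM => /pE/Pprime[/pE|/pE]; [left|right].
exists K, (f \o kalg_str Q), (khom_comp (@KHom k Q (KAlg (f \o kalg_str Q)) f (fun=> erefl)) p).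
split=> x; first by move=> /JP/pE /= ->; rewrite rmorph0.
by move=> Sx /=; rewrite -(rmorph0 f) => /finj/pE/PS.
Qed.

End Ideals.

(** * Subalgebras *)

Section Subalgebra.
Variable k : fieldType.
Implicit Types A B C T : kalg k.

Definition subalgebra B (X : set B) : Prop :=
  [/\ forall c, X (kalg_str B c), forall x y, X x -> X y -> X (x + y) &
      forall x y, X x -> X y -> X (x * y)].

Lemma subalgebra_exists B (X : set B) : subalgebra X ->
  exists (C : kalg k) (i : khom C B), injective i /\ forall b, X b <-> exists c, i c = b.
Proof.
case=> Xk XD XM.
have XN x : X x -> X (- x).
  by move=> Xx; rewrite -mulN1r -(rmorph1 (kalg_str B)) -rmorphN; apply: XM.
pose P : pred B := fun x => `[< X x >].
have Pc : GRing.subring_closed P.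
  split; first by apply/asboolP; rewrite -(rmorph1 (kalg_str B)).
    by move=> x y /asboolP Xx /asboolP Xy; apply/asboolP/XD => //; apply: XN.
  by move=> x y /asboolP Xx /asboolP Xy; apply/asboolP/XM.
pose U := {x : B | P x}.
pose R := HB.pack_for (subComPzRingType P) U
  (GRing.SubChoice_isSubComPzRing.Build B P U Pc).
have [|||st stE] := @rmorph_exists k R
  (fun c => exist _ (kalg_str B c) (asboolT (Xk c)) : R).
- by apply: val_inj; rewrite /= !rmorph1.
- by move=> x y; apply: val_inj; rewrite /= !rmorphD.
- by move=> x y; apply: val_inj; rewrite /= !rmorphM.
have [||||i iE] := @khom_exists k (KAlg st) B (val : R -> B).
- by [].
- by move=> x y.
- by move=> x y.
- by move=> c; rewrite /= -stE.
exists (KAlg st), i; split=> [x y|b]; first by rewrite -!iE => /val_inj.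
split=> [Xb|[c <-]].
  by exists (exist _ b (asboolT Xb) : R); rewrite -iE.
by rewrite -iE; apply/asboolP/(svalP c).
Qed.

Lemma subalgebra_sum A (X : set A) (I : eqType) (r : seq I) (F : I -> A) :
  subalgebra X -> (forall i, i \in r -> X (F i)) -> X (\sum_(i <- r) F i).
Proof.
case=> Xk XD _ XF; rewrite big_seq; elim/big_rec: _ => [|i x ri Xx].
  by rewrite -(rmorph0 (kalg_str A)).
by apply: XD => //; apply: XF.
Qed.

Definition gen_subalgebra B (G : set B) : set B :=
  fun b => forall X, subalgebra X -> (G `<=` X)%classic -> X b.

Lemma gen_subalgebraP B (G : set B) : subalgebra (gen_subalgebra G).
Proof.
split=> [c X [Xk _ _] _|x y xG yG X Xsub GX|x y xG yG X Xsub GX].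
- exact: Xk.
- by case: (Xsub) => _ XD _; apply: XD; [apply: xG|apply: yG].
- by case: (Xsub) => _ _ XM; apply: XM; [apply: xG|apply: yG].
Qed.

(** The last clause is induction on the generators, stated inside the generated
    algebra so that it applies to predicates that do not extend to [B]. *)
Lemma generated_algebra B (G : set B) : exists (C : kalg k) (i : khom C B),
  [/\ injective i, forall g, G g -> exists c, i c = g &
      forall X : set C, subalgebra X -> (forall c, G (i c) -> X c) ->
        forall c, X c].
Proof.
have [C [i [iinj iP]]] := subalgebra_exists (gen_subalgebraP G).
exists C, i; split=> // [g Gg|X [Xk XD XM] GX c].
  by apply/iP => X _; apply.
have /iP : exists c', i c' = i c by exists c.
move=> /(_ (fun b => exists2 c', X c' & i c' = b))[||c' Xc' /iinj <- //].
  split=> [a|_ _ [x Xx <-] [y Xy <-]|_ _ [x Xx <-] [y Xy <-]].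
  - by exists (kalg_str C a); [exact: Xk|rewrite khom_str].
  - by exists (x + y); [exact: XD|rewrite rmorphD].
  - by exists (x * y); [exact: XM|rewrite rmorphM].
move=> b Gb; have /iP[c' c'b] : gen_subalgebra G b by move=> Y _; apply.
by exists c' => //; apply: GX; rewrite c'b.
Qed.

Lemma inj_lift A B C (i : khom C B) (f : khom A B) : injective i ->
  (forall a, exists c, i c = f a) -> exists g : khom A C, khom_comp i g = f.
Proof.
move=> iinj fi; pose r a := sval (cid (fi a)).
have rE a : i (r a) = f a := svalP (cid (fi a)).
have [||||g gE] := @khom_exists k A C r.
- by apply: iinj; rewrite rE !rmorph1.
- by move=> x y; apply: iinj; rewrite rmorphD !rE rmorphD.
- by move=> x y; apply: iinj; rewrite rmorphM !rE rmorphM.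
- by move=> c; apply: iinj; rewrite rE !khom_str.
by exists g; apply: khomP => a; rewrite /= -gE rE.
Qed.

Lemma khom_preimage_subalgebra A B (f : khom A B) (X : set B) :
  subalgebra X -> subalgebra (fun a => X (f a)).
Proof.
case=> Xk XD XM; split=> [c|x y Xx Xy|x y Xx Xy].
- by rewrite khom_str.
- by rewrite rmorphD; apply: XD.
- by rewrite rmorphM; apply: XM.
Qed.

Lemma khom_image_subalgebra A B (f : khom A B) :
  subalgebra (fun b => exists a, f a = b).
Proof.
split=> [c|_ _ [x <-] [y <-]|_ _ [x <-] [y <-]].
- by exists (kalg_str A c); rewrite khom_str.
- by exists (x + y); rewrite rmorphD.
- by exists (x * y); rewrite rmorphM.
Qed.

Lemma khom_equalizer_subalgebra A B (f g : khom A B) :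
  subalgebra (fun a => f a = g a).
Proof.
split=> [c|x y Ex Ey|x y Ex Ey]; first by rewrite !khom_str.
  by rewrite !rmorphD Ex Ey.
by rewrite !rmorphM Ex Ey.
Qed.

End Subalgebra.

(** * Amalgamation over a common subalgebra *)

Section Amalgam.

Lemma fraction_lift (D : comPzRingType) (F K : fieldType)
    (f : {rmorphism D -> F}) (g : {rmorphism D -> K}) :
  injective f -> injective g ->
  (forall x : F, exists n d, f d <> 0 /\ x * f d = f n) ->
  exists h : {rmorphism F -> K}, forall d, h (f d) = g d.
Proof.
move=> finj ginj frac.
have fg d : f d <> 0 -> g d != 0.
  move=> fd; apply/eqP => gd; apply: fd.
  by rewrite (_ : d = 0) ?rmorph0 //; apply: ginj; rewrite gd rmorph0.
have ex x : exists y, forall n d, f d <> 0 -> x * f d = f n -> y * g d = g n.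
  have [n [d [fd xd]]] := frac x; exists (g n / g d) => n' d' fd' xd'.
  apply: (mulIf (fg _ fd)); rewrite mulrAC divfK; last exact: fg.
  rewrite -!rmorphM; apply: (congr1 g); apply: finj; rewrite !rmorphM -xd -xd'.
  by rewrite mulrAC.
pose h x := sval (cid (ex x)).
have hE x n d : f d <> 0 -> x * f d = f n -> h x * g d = g n.
  by move: n d; exact: (svalP (cid (ex x))).
have f1 : f 1 <> 0 by rewrite rmorph1; apply/eqP/oner_neq0.
have fM d d' : f d <> 0 -> f d' <> 0 -> f (d * d') <> 0.
  by move=> /eqP fd /eqP fd'; apply/eqP; rewrite rmorphM mulf_neq0.
have hf d : h (f d) = g d.
  by have := hE (f d) d 1 f1; rewrite !rmorph1 !mulr1; apply.
have [|||H HE] := @rmorph_exists F K h.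
- by rewrite -(rmorph1 f) hf rmorph1.
- move=> x y; have [n [d [fd xd]]] := frac x; have [m [e [fe ye]]] := frac y.
  apply: (mulIf (fg _ (fM _ _ fd fe))).
  rewrite (hE (x + y) (n * e + m * d)); first 1 last.
  + exact: fM.
  + by rewrite rmorphD !rmorphM -xd -ye mulrDl mulrA [f d * f e]mulrC mulrA.
  rewrite rmorphD !rmorphM -(hE x n d) // -(hE y m e) // mulrDl mulrA.
  by congr (_ + _); rewrite -!mulrA; congr (_ * _); rewrite mulrC.
- move=> x y; have [n [d [fd xd]]] := frac x; have [m [e [fe ye]]] := frac y.
  apply: (mulIf (fg _ (fM _ _ fd fe))).
  rewrite (hE (x * y) (n * m)); first 1 last.
  + exact: fM.
  + by rewrite !rmorphM -xd -ye mulrACA.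
  by rewrite !rmorphM -(hE x n d) // -(hE y m e) // mulrACA.
by exists H => d; rewrite -HE hf.
Qed.

Variable k : fieldType.
Implicit Types A B C T : kalg k.

(** Two dominant morphisms to [Spec A] meet.  The complement of a maximal
    multiplicative set [S] without [0] is a minimal prime of [A], so every
    prime of [B] disjoint from [S] lies over it, and likewise for [C]; such primes
    exist since [A] embeds in both.  Over the fraction field [F] at the minimal
    prime, the residue fields of [B] and [C] are nonzero vector spaces, and their
    tensor product over [F] is the common extension. *)
Lemma amalgam A B C (i : khom A B) (j : khom A C) :
  injective i -> injective j -> (1 : A) <> 0 ->
  exists (L : kalg k) (u : khom B L) (v : khom C L),
    (1 : L) <> 0 /\ khom_comp u i = khom_comp v j.
Proof.
move=> iinj jinj A1.
have [||S [_ [[S1 SM] S0] Smax]] := @Zorn_above A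
  (fun S => multiplicative_set S /\ ~ S 0) (fun a => a = 1).
- by split; [split=> // x y -> ->; rewrite mulr1|move=> /esym].
- move=> F [X0 FX0] FP _ Ftot; split; last by case=> X /FP[].
  split; first by exists X0 => //; case: (FP _ FX0) => -[].
  move=> x y [X FX Xx] [Y FY Yy]; have [XY|YX] := Ftot _ _ FX FY.
    by exists Y => //; case: (FP _ FY) => -[_ YM] _; apply: YM => //; apply: XY.
  by exists X => //; case: (FP _ FX) => -[_ XM] _; apply: XM => //; apply: YX.
(* a point of [E] in a field lying over the minimal prime [~` S] *)
have pt E (l : khom A E) : injective l -> exists (K : fieldType)
    (st : {rmorphism k -> K}) (u : khom E (KAlg st)),
    forall a, u (l a) = 0 <-> ~ S a.
  move=> linj.
  have [|||K [st [u [_ uS]]]] :=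
    @field_point k E (fun x => x = 0) (fun x => exists2 a, S a & x = l a).
  - by split=> [|x y -> ->|a x ->]; rewrite ?addr0 ?mulr0.
  - split; first by exists 1; rewrite ?rmorph1.
    by move=> _ _ [a Sa ->] [b Sb ->]; exists (a * b); rewrite ?rmorphM //; apply: SM.
  - by move=> _ -> [a Sa /esym]; rewrite -(rmorph0 l) => /linj a0; rewrite a0 in Sa.
  exists K, st, u => a; split=> [ua Sa|nSa].
    by apply: (uS (l a)) ua; exists a.
  apply: contrapT => ua; apply: nSa.
  apply: (Smax (fun a => u (l a) <> 0)); last exact: ua.
  - by move=> b Sb; apply: uS; exists b.
  - split; last by apply; rewrite !rmorph0.
    split; first by rewrite !rmorph1; apply/eqP/oner_neq0.
    move=> x y /eqP ux /eqP uy; apply/eqP.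
    by rewrite !rmorphM; apply: (mulf_neq0 (ux : (_ : K) != 0) uy).
have [K [st [u uS]]] := pt _ i iinj; have [K' [st' [v vS]]] := pt _ j jinj.
have Jid : ideal (fun a => ~ S a).
  split; first by [].
  - by move=> x y /uS ux /uS uy; apply/uS; rewrite !rmorphD ux uy addr0.
  - by move=> a x /uS ux; apply/uS; rewrite !rmorphM ux mulr0.
have [D [q [qE qsurj]]] := quotient_exists Jid.
have [|f fE] := @surj_lift k A D _ q (khom_comp u i) qsurj; first by move=> x /qE/uS.
have [|g gE] := @surj_lift k A D _ q (khom_comp v j) qsurj; first by move=> x /qE/vS.
have fE' a : f (q a) = u (i a) := congr1 (fun h : khom _ _ => h a) fE.
have gE' a : g (q a) = v (j a) := congr1 (fun h : khom _ _ => h a) gE.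
have finj : injective f.
  by apply: khom_inj => d; have [a ->] := qsurj d; rewrite fE' => /uS/qE.
have ginj : injective g.
  by apply: khom_inj => d; have [a ->] := qsurj d; rewrite gE' => /vS/qE.
have [||F [fr [frinj frac]]] := @domain_fraction_field D.
- by rewrite -(rmorph1 q) => /qE.
- move=> x y xy; have /eqP : f x * f y = 0 by rewrite -rmorphM xy rmorph0.
  rewrite (mulf_eq0 (f x : K)) => /orP[] /eqP.
    by rewrite -(rmorph0 f) => /finj; left.
  by rewrite -(rmorph0 f) => /finj; right.
have [h hE] := @fraction_lift D F K fr f frinj finj frac.
have [h' hE'] := @fraction_lift D F K' fr g frinj ginj frac.
pose T := tens (@KAlg F K h) (@KAlg F K' h').
have T1 : (1 : T) <> 0 by apply: tens_nonzero; apply/eqP/oner_neq0.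
pose a1 : {rmorphism K -> T} := @in1 F (@KAlg F K h) (@KAlg F K' h').
pose a2 : {rmorphism K' -> T} := @in2 F (@KAlg F K h) (@KAlg F K' h').
have a12 d : a1 (f d) = a2 (g d).
  rewrite -hE -hE'; transitivity (kalg_str T (fr d)).
    exact: (khom_str (@in1 F (@KAlg F K h) (@KAlg F K' h'))).
  by rewrite -(khom_str (@in2 F (@KAlg F K h) (@KAlg F K' h'))).
pose L := @KAlg k T (a1 \o st).
have c1 c : a1 (kalg_str (KAlg st) c) = kalg_str L c by [].
have c2 c : a2 (kalg_str (KAlg st') c) = kalg_str L c.
  by rewrite -(khom_str g) -a12 khom_str.
exists L, (khom_comp (@KHom k (KAlg st) L a1 c1) u),
  (khom_comp (@KHom k (KAlg st') L a2 c2) v); split=> //.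
by apply: khomP => a /=; rewrite -fE' -gE' a12.
Qed.

End Amalgam.
(** * Nullstellensatz for finitely generated algebras *)

Section Nullstellensatz.
Variable k : closedFieldType.

Lemma poly_nonroot (p : {poly k}) : p != 0 -> exists x, p.[x] != 0.
Proof.
move=> pN0; have [/size1_polyC pC|sp] := leqP (size p) 1.
  exists 0; apply: contraNneq pN0 => p0; rewrite pC in p0 *.
  by rewrite hornerC in p0; rewrite p0.
have [|x /rootP] := closed_rootP (p - 1) _.
  rewrite size_polyDl ?size_polyN ?size_poly1 //.
  by case: (size p) sp => [|[]].
rewrite hornerD hornerN hornerC => /subr0_eq p1; exists x.
by rewrite p1 oner_neq0.
Qed.

(** [P] presents a subring of the field [L] by generators.  Asking for a
    specialization that keeps a prescribed [s] nonzero is what makes the induction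
    on the number of generators work: the leading coefficients met in the next
    step must not be killed. *)
Definition specializable (P : idomainType) (L : fieldType)
    (iP : {rmorphism k -> P}) (e : {rmorphism P -> L}) : Prop :=
  forall s, e s != 0 -> exists f : {rmorphism P -> k},
    [/\ forall c, f (iP c) = c, forall p, e p = 0 -> f p = 0 & f s != 0].

Section OneGenerator.
Variables (P : idomainType) (L : fieldType).
Variables (iP : {rmorphism k -> P}) (e : {rmorphism P -> L}) (c : L).
Hypothesis eP : specializable iP e.

Local Notation "G ^e" := (map_poly e G) (at level 2, format "G ^e").

Let size_e (G : {poly P}) : (size G^e <= size G)%N.
Proof. by rewrite map_polyE; apply: leq_trans (size_Poly _) _; rewrite size_map. Qed.

Let trim (G : {poly P}) : exists G' : {poly P}, G'^e = G^e /\ size G' = size G^e.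
Proof.
exists (take_poly (size G^e) G); have E : (take_poly (size G^e) G)^e = G^e.
  apply/polyP => i; rewrite !coef_map coef_take_poly /=; case: ltnP => // H.
  by rewrite rmorph0 -coef_map nth_default.
split=> //; apply/eqP; rewrite eqn_leq size_take_poly /=.
by rewrite -[in X in (X <= _)%N]E size_e.
Qed.

(** If [c] is transcendental it may be sent anywhere outside the roots of the
    specialized polynomial. *)
Lemma specializable_transcendental :
  (forall G : {poly P}, G^e.[c] = 0 -> G^e = 0) ->
  forall e' : {rmorphism {poly P} -> L}, (forall G, e' G = G^e.[c]) ->
  specializable (polyC \o iP) e'.
Proof.
move=> trans e' e'E G; rewrite e'E => Gc.
have : G^e != 0 by apply: contraNneq Gc => ->; rewrite horner0.
rewrite -lead_coef_eq0 lead_coefE coef_map => /eP[f [fk fe fG]].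
have [|x xG] := @poly_nonroot (map_poly f G).
  by apply: contraNneq fG => G0; rewrite -coef_map G0 coef0.
have [|||f' f'E] := @rmorph_exists {poly P} k (fun H => (map_poly f H).[x]).
- by rewrite rmorph1 hornerC.
- by move=> H K; rewrite rmorphD hornerD.
- by move=> H K; rewrite rmorphM hornerM.
exists f'; split=> [a|H|]; rewrite -?f'E //.
  by rewrite /= map_polyC hornerC; apply: fk.
rewrite e'E => /trans H0; rewrite (_ : map_poly f H = 0) ?horner0 //.
by apply/polyP => i; rewrite coef_map coef0; apply: fe; rewrite -coef_map H0 coef0.
Qed.

(** If [c] is algebraic, let [F] be a relation of minimal degree [d] and [a] its
    leading coefficient.  Pseudo-division by [F] shows that any root of the
    specialization of [F] extends a specialization that keeps [a] nonzero.  The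
    value of [G] at [c] stays nonzero if some multiple of it that lies in the base
    does; Euclid's algorithm with [F] produces such a multiple [r0]. *)
Lemma specializable_algebraic (G0 : {poly P}) : G0^e.[c] = 0 -> G0^e != 0 ->
  forall e' : {rmorphism {poly P} -> L}, (forall G, e' G = G^e.[c]) ->
  specializable (polyC \o iP) e'.
Proof.
move=> G0c G0N0 e' e'E.
pose Q n := `[< exists G : {poly P}, [/\ G^e.[c] = 0, G^e != 0 & size G^e = n] >].
have exQ : exists n, Q n by exists (size G0^e); apply/asboolP; exists G0.
case: (ex_minnP exQ) => d /asboolP[F1 [F1c F1N0 F1d]] dmin.
have [F [FE Fd]] := trim F1; rewrite F1d in Fd; rewrite -FE in F1c F1N0 F1d.
have small G : G^e.[c] = 0 -> (size G^e < d)%N -> G^e = 0.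
  move=> Gc Gd; apply/eqP; apply: contraTT Gd => GN0; rewrite -leqNgt.
  by apply: dmin; apply/asboolP; exists G.
have small' G : G^e.[c] = 0 -> (size G < d)%N -> G^e = 0.
  by move=> Gc Gd; apply: small => //; apply: leq_ltn_trans (size_e _) Gd.
have d_gt1 : (1 < d)%N.
  rewrite ltnNge -F1d; apply/negP => /size1_polyC FC.
  by move: F1c F1N0; rewrite FC hornerC => ->; rewrite polyC0 eqxx.
have FN0 : F != 0 by rewrite -size_poly_gt0 Fd ltnW.
have leadN0 (G : {poly P}) : size G = size G^e -> G^e != 0 -> e (lead_coef G) != 0.
  by move=> Gs GN0; rewrite lead_coefE Gs -coef_map -lead_coefE lead_coef_eq0.
have aN0 : e (lead_coef F) != 0 by apply: leadN0 => //; rewrite Fd.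
have pdiv (G H : {poly P}) : H != 0 -> exists N (q r : {poly P}),
    lead_coef H ^+ N *: G = q * H + r /\ (size r < size H)%N.
  move=> HN0; exists (scalp G H), (G %/ H), (G %% H).
  by rewrite -Pdiv.Idomain.divp_eq ltn_modp.
have evZ a (G : {poly P}) : (a *: G)^e.[c] = e a * G^e.[c].
  by rewrite map_polyZ hornerZ.
have evD (G H : {poly P}) : (G + H)^e.[c] = G^e.[c] + H^e.[c].
  by rewrite rmorphD hornerD.
have evM (G H : {poly P}) : (G * H)^e.[c] = G^e.[c] * H^e.[c].
  by rewrite rmorphM hornerM.
(* a nonzero value of degree below [d] has a nonzero multiple in the base *)
have inv_small n (G : {poly P}) : (size G < n)%N -> (size G < d)%N -> G^e.[c] != 0 ->
    exists r0 V, e r0 != 0 /\ e r0 = (V * G)^e.[c].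
  elim: n G => // n IH G Gn Gd Gc.
  have [G' [G'E G's]] := trim G.
  have G'N0 : G'^e != 0 by rewrite G'E; apply: contraNneq Gc => ->; rewrite horner0.
  have bN0 : e (lead_coef G') != 0 by apply: leadN0 => //; rewrite G's G'E.
  have G'd : (size G' < d)%N by rewrite G's; apply: leq_ltn_trans (size_e _) Gd.
  have G'n : (size G' <= n)%N.
    by rewrite G's; apply: leq_trans (size_e _) _; rewrite -ltnS.
  have G'0 : G' != 0 by apply: contraNneq G'N0 => ->; rewrite rmorph0.
  have [G'1|G'1] := leqP (size G') 1.
    have G'C := size1_polyC G'1; exists G'`_0, 1; rewrite mul1r -G'E.
    have G'eC : G'^e = (e G'`_0)%:P by rewrite {1}G'C map_polyC.
    by rewrite G'eC hornerC; split=> //; move: G'N0; rewrite G'eC polyC_eq0.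
  have [N [q [r [E rs]]]] := pdiv F G' G'0.
  have Hc : r^e.[c] = - (q^e.[c] * G^e.[c]).
    have := congr1 (fun G => G^e.[c]) E; rewrite /= evZ F1c mulr0 evD evM G'E.
    by move/esym/eqP; rewrite addrC addr_eq0 => /eqP.
  have rN0 : r^e.[c] != 0.
    apply/negP => /eqP r0.
    have re0 : r^e = 0 by apply: small' => //; apply: ltn_trans rs G'd.
    have := congr1 (map_poly e) E; rewrite map_polyZ rmorphD rmorphM /= re0 addr0.
    move=> E'; have ZN0 : e (lead_coef G' ^+ N) *: F^e != 0.
      by rewrite scaler_eq0 negb_or F1N0 andbT rmorphXn expf_neq0.
    have qN0 : q^e != 0 by apply: contraNneq ZN0 => q0; rewrite E' q0 mul0r.
    have qc : q^e.[c] = 0.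
      by move/eqP: r0; rewrite Hc oppr_eq0 mulf_eq0 (negPf Gc) orbF => /eqP.
    suff /(small q qc)/eqP : (size q^e < d)%N by rewrite (negPf qN0).
    have : size (q^e * G'^e) = d by rewrite -E' size_scale // rmorphXn expf_neq0.
    rewrite size_mul //= G'E -G's => <-.
    by case: (size G') G'1 => [|[|m]] // _; rewrite !addnS /= ltnS leq_addr.
  have [|||r0 [V [r0N0 r0E]]] := IH r.
  - exact: leq_trans rs G'n.
  - exact: ltn_trans rs G'd.
  - exact: rN0.
  exists r0, (- (V * q)); split=> //.
  by rewrite r0E evM Hc mulNr rmorphN hornerN -mulrA !evM mulrN.
move=> G; rewrite e'E => Gc.
have [N [q [r [E rs]]]] := pdiv G F FN0.
have rc : r^e.[c] = e (lead_coef F) ^+ N * G^e.[c].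
  have := congr1 (fun G => G^e.[c]) E.
  by rewrite /= evZ evD evM F1c mulr0 add0r rmorphXn.
have [|||r0 [V [r0N0 r0E]]] := inv_small (size r).+1 r.
- by [].
- by rewrite -Fd.
- by rewrite rc mulf_neq0 // expf_neq0.
have [|f [fk fe]] := @eP (lead_coef F * r0); first by rewrite rmorphM mulf_neq0.
rewrite rmorphM mulf_eq0 negb_or => /andP[faN0 fr0N0].
have sfF : size (map_poly f F) = d.
  by rewrite -Fd size_poly_eq.
have [|x /rootP Fx] := closed_rootP (map_poly f F) _.
  by rewrite sfF; case: (d) d_gt1 => [|[]].
have [|||f' f'E] := @rmorph_exists {poly P} k (fun H => (map_poly f H).[x]).
- by rewrite rmorph1 hornerC.
- by move=> H K; rewrite rmorphD hornerD.
- by move=> H K; rewrite rmorphM hornerM.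
have kerf H : H^e = 0 -> map_poly f H = 0.
  move=> H0; apply/polyP => i; rewrite coef_map coef0; apply: fe.
  by rewrite -coef_map H0 coef0.
have kill H : H^e.[c] = 0 -> (map_poly f H).[x] = 0.
  move=> Hc; have [M [q' [r' [E' rs']]]] := pdiv H F FN0.
  have r'0 : r'^e = 0.
    apply: small'; last by rewrite -Fd.
    have := congr1 (fun G => G^e.[c]) E'.
    by rewrite /= evZ evD evM F1c Hc !mulr0 add0r => <-.
  have : (map_poly f (lead_coef F ^+ M *: H)).[x] = 0.
    rewrite E' rmorphD hornerD rmorphM hornerM Fx mulr0 add0r.
    by rewrite /= (kerf _ r'0) horner0.
  rewrite map_polyZ hornerZ rmorphXn => /eqP; rewrite mulf_eq0 expf_eq0.
  by rewrite (negPf faN0) andbF => /eqP.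
exists f'; split=> [a|H|].
- by rewrite -f'E /= map_polyC hornerC; apply: fk.
- by rewrite e'E -f'E; apply: kill.
- rewrite -f'E; apply: contraNneq fr0N0 => fG0.
  have : (r0%:P - V * (lead_coef F ^+ N *: G))^e.[c] = 0.
    rewrite evD [(- _)^e]rmorphN hornerN map_polyC hornerC /= r0E !evM evZ rmorphXn rc.
    by rewrite subrr.
  move/kill; rewrite [map_poly f _]rmorphB hornerD hornerN /= map_polyC hornerC /=.
  rewrite [map_poly f (V * _)]rmorphM hornerM /= [map_poly f (_ *: _)]map_polyZ.
  by rewrite hornerZ fG0 !mulr0 subr0 => ->.
Qed.

End OneGenerator.

Lemma specializable_tower (L : fieldType) (st : {rmorphism k -> L}) (s : seq L) :
  exists (P : idomainType) (iP : {rmorphism k -> P}) (e : {rmorphism P -> L}),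
    [/\ specializable iP e, forall c, e (iP c) = st c &
        forall x, x \in s -> exists p, e p = x].
Proof.
elim: s => [|c s [P [iP [e [eP eE es]]]]].
  exists k, (idfun : {rmorphism k -> k}), st; split=> // x sx.
  rewrite fmorph_eq0 in sx; exists (idfun : {rmorphism k -> k}); split=> //.
  by move=> p /eqP; rewrite fmorph_eq0 => /eqP.
have [|||e' e'E] := @rmorph_exists {poly P} L (fun H => (map_poly e H).[c]).
- by rewrite rmorph1 hornerC.
- by move=> H K; rewrite rmorphD hornerD.
- by move=> H K; rewrite rmorphM hornerM.
exists {poly P}, (polyC \o iP), e'; split.
- have [trans|] := pselect (forall G : {poly P}, (map_poly e G).[c] = 0 -> map_poly e G = 0).
    by apply: (specializable_transcendental eP trans) => G; rewrite -e'E.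
  move/existsNP => [G /not_implyP[Gc /eqP GN0]].
  by apply: (specializable_algebraic eP Gc GN0) => H; rewrite -e'E.
- by move=> a; rewrite -e'E /= map_polyC hornerC; apply: eE.
- move=> x; rewrite inE => /orP[/eqP ->|/es[p <-]].
    by exists 'X; rewrite -e'E map_polyX hornerX.
  by exists p%:P; rewrite -e'E map_polyC hornerC.
Qed.

Lemma nullstellensatz (B : kalg k) (s : seq B) : (1 : B) <> 0 ->
  (forall X : set B, subalgebra X -> (forall b, b \in s -> X b) -> forall b, X b) ->
  inhabited (khom B (kalg_base k)).
Proof.
move=> B1 Bgen.
have [|||K [st [u _]]] := @field_point k B (fun x => x = 0) (fun x => x = 1).
- by split=> [|x y -> ->|a x ->]; rewrite ?addr0 ?mulr0.
- by split=> // x y -> ->; rewrite mulr1.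
- by move=> x -> /esym.
have [P [iP [e [eP eE es]]]] := specializable_tower st [seq u b | b <- s].
have [|f [fk fe _]] := eP 1; first by rewrite rmorph1 oner_neq0.
have ex b : exists p, e p = u b.
  move: b; apply: Bgen.
    split=> [c|x y [p pE] [q qE]|x y [p pE] [q qE]].
    - by exists (iP c); rewrite eE khom_str.
    - by exists (p + q); rewrite rmorphD pE qE rmorphD.
    - by exists (p * q); rewrite rmorphM pE qE rmorphM.
  by move=> b sb; apply: es; apply: map_f.
pose r b := sval (cid (ex b)).
have rE b : e (r b) = u b := svalP (cid (ex b)).
have fr p q : e p = e q -> f p = f q.
  by move=> pq; apply/subr0_eq; rewrite -rmorphB; apply: fe; rewrite rmorphB pq subrr.
have [||||g _] := @khom_exists k B (kalg_base k) (f \o r).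
- by rewrite /= -[RHS](rmorph1 f); apply: fr; rewrite rE !rmorph1.
- by move=> x y; rewrite /= -rmorphD; apply: fr; rewrite rmorphD !rE rmorphD.
- by move=> x y; rewrite /= -rmorphM; apply: fr; rewrite rmorphM !rE rmorphM.
- by move=> c; rewrite /= -[RHS]fk; apply: fr; rewrite rE eE khom_str.
exact: (inhabits g).
Qed.

End Nullstellensatz.
(** * Heaps and their coordinate algebras *)

Section Heap.
Variable k : fieldType.
Implicit Types A B C T : kalg k.

(** A heap structure on [Spec B], given on points: [t x y z] stands for
    [x y^-1 z].  A torsor carries it without reference to its group. *)
Definition is_heap B (t : forall T, khom B T -> khom B T -> khom B T -> khom B T) :=
  [/\ forall T S (g : khom T S) x y z,
        khom_comp g (t T x y z) = t S (khom_comp g x) (khom_comp g y) (khom_comp g z),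
      forall T x y, t T x x y = y,
      forall T x y, t T x y y = x &
      forall T x y z u v, t T (t T x y z) u v = t T x y (t T z u v)].

(** The ideal of a nonempty closed subheap. *)
Definition subheap_ideal B (t : forall T, khom B T -> khom B T -> khom B T -> khom B T)
    (J : set B) : Prop :=
  [/\ ideal J, ~ J 1 & forall T (y1 y2 y3 : khom B T),
    (forall x, J x -> y1 x = 0) -> (forall x, J x -> y2 x = 0) ->
    (forall x, J x -> y3 x = 0) -> forall x, J x -> t T y1 y2 y3 x = 0].

Section LocalFiniteness.
Variable B : kalg k.
Variable t : forall T, khom B T -> khom B T -> khom B T -> khom B T.
Hypothesis heap_t : is_heap t.
Hypothesis B1 : (1 : B) <> 0.
Arguments t {T}.

Let tnat T S (g : khom T S) x y z :
  khom_comp g (t x y z) = t (khom_comp g x) (khom_comp g y) (khom_comp g z).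
Proof. by case: heap_t => H _ _ _; apply: H. Qed.
Let txxy T (x y : khom B T) : t x x y = y.
Proof. by case: heap_t => _ H _ _; apply: H. Qed.
Let txyy T (x y : khom B T) : t x y y = x.
Proof. by case: heap_t => _ _ H _; apply: H. Qed.
Let tA T (x y z u v : khom B T) : t (t x y z) u v = t x y (t z u v).
Proof. by case: heap_t => _ _ _ H; apply: H. Qed.

Local Notation B2 := (tens B B).
Local Notation B3 := (tens B (tens B B)).
Let Y : khom B B3 := in1.
Let Z : khom B B3 := khom_comp in2 in1.
Let W : khom B B3 := khom_comp in2 in2.

(* the heap operation is determined by its value at the generic triple *)
Let generic T (y z w : khom B T) b :
  tpair y (tpair z w) (t Y Z W b) = t y z w b.
Proof.
rewrite -[LHS]/(khom_comp _ _ b) tnat /Y /Z /W.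
by rewrite !khom_compA tpair_in1 !tpair_in2 tpair_in1.
Qed.

(** Writing [b (y z^-1 w) = sum_i v_i (y) c0_i (z, w)] with independent [v] and
    [c0], each [v_i] is recovered by contracting against a functional dual to
    [c0_i].  Expanding [b (y z^-1 w u^-1 s)] in two ways and contracting in
    [(u, s)] shows that the span of [v] is stable under [y |-> y z^-1 w], with
    matrix [C (z, w)]. *)
Lemma heap_matrix_coefficients (b : B) :
  exists n (v : 'I_n -> B) (C : 'I_n -> 'I_n -> B2),
  [/\ indep v,
      forall T (y z w : khom B T) i,
        t y z w (v i) = \sum_j y (v j) * tpair z w (C j i) &
      exists c : 'I_n -> k, b = \sum_i kalg_str B (c i) * v i].
Proof.
have [n [v [c0 [vind cind bE]]]] := tens_indep (t Y Z W b).
have bE' T (y z w : khom B T) : t y z w b = \sum_i y (v i) * tpair z w (c0 i).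
  by rewrite -generic bE rmorph_sum; under eq_bigr do rewrite tpairE.
pose lam i := s2val (cid2 (indep_dual i cind)).
have llam i : klin (lam i) := s2valP (cid2 (indep_dual i cind)).
have lamE i j : lam i (c0 j) = (j == i)%:R := s2valP' (cid2 (indep_dual i cind)) j.
pose h : khom B2 (tens B2 B2) := tpair (khom_comp in2 in1)
  (t (khom_comp in2 in2) (khom_comp in1 in1) (khom_comp in1 in2)).
pose C j i := slice (llam i) (h (c0 j)).
have gen i : t Y Z W (v i) = \sum_j in1 (v j) * in2 (C j i).
  pose U := tens B2 B3.
  pose u : khom B U := khom_comp in1 in1.
  pose s : khom B U := khom_comp in1 in2.
  pose y : khom B U := khom_comp in2 Y.
  pose z : khom B U := khom_comp in2 Z.
  pose w : khom B U := khom_comp in2 W.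
  have E1 : t (t y z w) u s b = \sum_j in1 (c0 j) * in2 (t Y Z W (v j)).
    rewrite bE'; apply: eq_bigr => j _; rewrite mulrC; congr (_ * _).
      apply: khom_congr.
      by apply: tens_ext; rewrite ?tpair_in1 ?tpair_in2.
    by rewrite -tnat.
  have E2 : t (t y z w) u s b =
      \sum_j in2 (in1 (v j)) * tpair in1 (khom_comp in2 in2) (h (c0 j)).
    rewrite tA bE'; apply: eq_bigr => j _; congr (_ * _).
    rewrite -[RHS]/(khom_comp _ _ (c0 j)); apply: khom_congr.
    apply: tens_ext; rewrite /h -khom_compA ?tpair_in1 ?tpair_in2.
      by rewrite khom_compA tpair_in2 -khom_compA.
    by rewrite tnat !khom_compA tpair_in1 tpair_in2 -!khom_compA.
  rewrite -(slice_dual (fun j => t Y Z W (v j)) (llam i) (lamE i)) -E1 E2 slice_sum.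
  by apply: eq_bigr => j _; rewrite slice_in2 slice_natural.
exists n, v, C; split=> //.
  by move=> T y z w i; rewrite -generic gen rmorph_sum; under eq_bigr do rewrite tpairE.
(* at [w = z] this reads [b (y) = sum_i v_i (y) c0_i (z, z)]; contract in [z] *)
have [mu lmu muE] := indep_dual ord0 (indep1 B1).
exists (fun i => mu (tpair (khom_id B) (khom_id B) (c0 i))).
have : in2 b = \sum_i in2 (v i) *
    in1 (tpair (khom_id B) (khom_id B) (c0 i)) :> B2.
  rewrite -[in2 b]/(@in2 k B B b) -[in LHS](txyy in2 (@in1 k B B)) bE'.
  apply: eq_bigr => i _; congr (_ * _).
  rewrite -[RHS]/(khom_comp _ _ (c0 i)); apply: khom_congr.
  by apply: tens_ext; rewrite -khom_compA ?tpair_in1 ?tpair_in2; apply: khomP.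
move/(congr1 (slice lmu)).
rewrite -[in2 b]mul1r -(rmorph1 in1) sliceE (muE ord0) eqxx rmorph1 mul1r => ->.
by rewrite slice_sum; apply: eq_bigr => i _; rewrite mulrC sliceE.
Qed.

Section Cocycle.
Variables (n : nat) (v : 'I_n -> B) (C : 'I_n -> 'I_n -> B2).
Hypothesis vind : indep v.
Hypothesis vC : forall T (y z w : khom B T) i,
  t y z w (v i) = \sum_j y (v j) * tpair z w (C j i).

Let M T (z w : khom B T) : 'M[T]_n := \matrix_(j, i) tpair z w (C j i).

(** The matrices [M z w] represent the group element [z^-1 w], which explains
    this identity and the next three. *)
Lemma cocycle_heap T (z w u s : khom B T) :
  M z (t w u s) = M z w *m M u s.
Proof.
apply/matrixP => l i; rewrite !mxE; move: l.
apply: (@tens_sum_inj_indepl k B T n v _ _ vind).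
pose y : khom B (tens B T) := in1.
pose e (x : khom B T) : khom B (tens B T) := khom_comp in2 x.
have eC x x' (c : B2) : tpair (e x) (e x') c = in2 (tpair x x' c).
  by rewrite -[RHS]/(khom_comp _ _ c) tpair_comp.
transitivity (t y (e z) (t (e w) (e u) (e s)) (v i)).
  by rewrite vC; apply: eq_bigr => l _; rewrite -tnat eC.
rewrite -tA vC; under eq_bigr do rewrite vC mulr_suml.
rewrite exchange_big; apply: eq_bigr => l _ /=.
rewrite rmorph_sum mulr_sumr; apply: eq_bigr => j _.
by rewrite !mxE !eC rmorphM mulrA.
Qed.

Lemma cocycle_diag T (z : khom B T) : M z z = 1%:M.
Proof.
apply/matrixP => l i; rewrite !mxE; move: l.
apply: (@tens_sum_inj_indepl k B T n v _ _ vind).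
pose y : khom B (tens B T) := in1.
pose e (x : khom B T) : khom B (tens B T) := khom_comp in2 x.
have eC x x' (c : B2) : tpair (e x) (e x') c = in2 (tpair x x' c).
  by rewrite -[RHS]/(khom_comp _ _ c) tpair_comp.
transitivity (t y (e z) (e z) (v i)).
  by rewrite vC; apply: eq_bigr => l _; rewrite eC.
rewrite txyy (bigD1 i) //= eqxx rmorph1 mulr1 big1 ?addr0 // => j /negPf ji.
by rewrite ji rmorph0 mulr0.
Qed.

Lemma cocycleM T (z w s : khom B T) : M z w *m M w s = M z s.
Proof. by rewrite -cocycle_heap txxy. Qed.

Lemma cocycle_heap_left T (z u w s : khom B T) :
  M (t z u w) s = M w u *m M z s.
Proof.
have E : M w u *m M z s *m M s (t z u w) = 1%:M.
  by rewrite cocycle_heap mulmxA -(mulmxA (M w u)) cocycleM cocycle_diag mulmx1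
             cocycleM cocycle_diag.
by rewrite -[LHS]mul1mx -E -mulmxA cocycleM cocycle_diag mulmx1.
Qed.

Lemma cocycle_coef T (z w u s : khom B T) l i :
  tpair z (t w u s) (C l i) = \sum_j tpair z w (C l j) * tpair u s (C j i).
Proof.
have /matrixP/(_ l i) := cocycle_heap z w u s.
by rewrite !mxE => ->; apply: eq_bigr => j _; rewrite !mxE.
Qed.

Lemma cocycle_coef_left T (z u w s : khom B T) l i :
  tpair (t z u w) s (C l i) = \sum_j tpair w u (C l j) * tpair z s (C j i).
Proof.
have /matrixP/(_ l i) := cocycle_heap_left z u w s.
by rewrite !mxE => ->; apply: eq_bigr => j _; rewrite !mxE.
Qed.

End Cocycle.
(** Decompose [C_jl (z, w) = sum_p d_p (z) e_p (w)] with independent [d] and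
    independent [e], which are then contractions of [C].  The subalgebra generated
    by [v], [d] and [e] is stable: for [v] by the definition of [C], for [e] by
    contracting [C (z, w u^-1 s) = C (z, w) C (u, s)] in [z], and for [d] by
    contracting [C (z u^-1 w, s) = C (w, u) C (z, s)] in [s]. *)
Lemma function_in_finitely_generated_heap (b : B) :
  exists (D : kalg k) (i : khom D B) (s : seq D) (m : khom D (tens D (tens D D))),
  [/\ injective i,
      forall X : set D, subalgebra X -> (forall d, d \in s -> X d) -> forall d, X d,
      khom_comp (tmap i (tmap i i)) m = khom_comp (t Y Z W) i &
      exists d, i d = b].
Proof.
have [n [v [C [vind vC [c bE]]]]] := heap_matrix_coefficients b.
pose sC j l := sval (cid (tens_slices (C j l))).
have CE j l : C j l = \sum_(p <- sC j l) in1 p.1 * in2 p.2.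
  by case: (svalP (cid (tens_slices (C j l)))).
have sCE j l p : p \in sC j l ->
    (exists (lam : B -> k) (llam : klin lam), p.2 = slice llam (C j l)) /\
    (exists (lam : B -> k) (llam : klin lam), p.1 = slice llam (tswap B B (C j l))).
  by case: (svalP (cid (tens_slices (C j l)))) => _; apply.
pose gens : seq B := [seq v i | i <- enum 'I_n] ++
  flatten [seq [seq p.1 | p <- sC jl.1 jl.2] ++ [seq p.2 | p <- sC jl.1 jl.2]
          | jl <- enum (('I_n * 'I_n)%type : finType)].
have gv i : v i \in gens by rewrite mem_cat map_f ?mem_enum.
have gd j l p : p \in sC j l -> p.1 \in gens.
  move=> ps; rewrite mem_cat; apply/orP; right; apply/flatten_mapP.
  by exists (j, l); rewrite ?mem_enum // mem_cat map_f.
have ge j l p : p \in sC j l -> p.2 \in gens.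
  move=> ps; rewrite mem_cat; apply/orP; right; apply/flatten_mapP.
  by exists (j, l); rewrite ?mem_enum // mem_cat [X in _ || X]map_f ?orbT.
have [D [i [iinj igens igen]]] := generated_algebra (fun x => x \in gens).
(* preimage of a generator; the default [0] is never used on [gens] *)
pose r x : D := if pselect (exists d, i d = x) is left e then sval (cid e) else 0.
have rK x : x \in gens -> i (r x) = x.
  by move=> /igens ex; rewrite /r; case: pselect => // e; apply: (svalP (cid e)).
pose i3 := tmap i (tmap i i).
pose X : set B3 := fun x => exists y, i3 y = x.
have Xsub : subalgebra X := khom_image_subalgebra i3.
have [Xk XD XM] := Xsub.
have XY x : x \in gens -> X (Y x).
  by move=> xg; exists (in1 (r x)); rewrite /i3 /tmap tpair1 /= rK.
have XZ x : x \in gens -> X (Z x).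
  move=> xg; exists (in2 (in1 (r x))).
  by rewrite /i3 /tmap tpair2 /= tpair1 /= rK.
have XW x : x \in gens -> X (W x).
  move=> xg; exists (in2 (in2 (r x))).
  by rewrite /i3 /tmap tpair2 /= tpair2 /= rK.
have Xgens x : x \in gens -> X (t Y Z W x).
  rewrite mem_cat => /orP[/mapP[j _ ->]|].
    rewrite vC; apply: subalgebra_sum => // l _; apply: (XM); first exact: XY.
    rewrite CE rmorph_sum; apply: subalgebra_sum => // p ps.
    by rewrite tpairE; apply: (XM); [apply/XZ/gd/ps|apply/XW/ge/ps].
  move=> /flatten_mapP[[j l] _ /=]; rewrite mem_cat => /orP[] /mapP[p ps ->].
    have [_ [lam [llam ->]]] := sCE _ _ _ ps.
    rewrite -slice_natural.
    have -> : tpair in1 (khom_comp in2 (t Y Z W)) (tswap B B (C j l)) =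
        tpair (t (khom_comp in2 Y) (khom_comp in2 Z) (khom_comp in2 W)) in1 (C j l)
        :> tens B B3.
      rewrite -[LHS]/(khom_comp _ _ (C j l)); apply: khom_congr.
      by rewrite tpair_comp tpair_in1 tpair_in2 tnat.
    rewrite (cocycle_coef_left vind vC) slice_sum.
    apply: subalgebra_sum => // q _.
    have -> : tpair (khom_comp in2 W) (khom_comp in2 Z) (C j q) =
        in2 (tpair W Z (C j q)) :> tens B B3.
      by rewrite -[RHS]/(khom_comp _ _ _) tpair_comp.
    rewrite slice_in2; apply: (XM).
      rewrite CE rmorph_sum; apply: subalgebra_sum => // p' ps'.
      by rewrite tpairE; apply: (XM); [apply/XW/gd/ps'|apply/XZ/ge/ps'].
    rewrite CE rmorph_sum slice_sum; apply: subalgebra_sum => // p' ps'.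
    rewrite tpairE mulrC sliceE; apply: (XM); [exact: Xk|exact/XY/gd/ps'].
  have [[lam [llam ->]] _] := sCE _ _ _ ps.
  rewrite -slice_natural tnat (cocycle_coef vind vC) slice_sum.
  apply: subalgebra_sum => // q _.
  have -> : tpair (khom_comp in2 Z) (khom_comp in2 W) (C q l) =
      in2 (tpair Z W (C q l)) :> tens B B3.
    by rewrite -[RHS]/(khom_comp _ _ _) tpair_comp.
  rewrite mulrC slice_in2; apply: (XM).
    rewrite CE rmorph_sum; apply: subalgebra_sum => // p' ps'.
    by rewrite tpairE; apply: (XM); [apply/XZ/gd/ps'|apply/XW/ge/ps'].
  rewrite CE rmorph_sum slice_sum; apply: subalgebra_sum => // p' ps'.
  rewrite tpairE sliceE; apply: (XM); [exact: Xk|exact/XY/ge/ps'].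
have i3inj : injective i3 by apply: tmap_inj => //; apply: tmap_inj.
have [|m mE] := @inj_lift k D B3 _ i3 (khom_comp (t Y Z W) i) i3inj.
  move=> d; have : X (t Y Z W (i d)).
    move: d; apply: igen => [|d]; last exact: Xgens.
    exact: (khom_preimage_subalgebra (khom_comp (t Y Z W) i) Xsub).
  by case=> y yE; exists y.
exists D, i, [seq r x | x <- gens], m; split=> //.
- move=> P Psub Ps; apply: igen => // d dg.
  by rewrite (_ : d = r (i d)); [apply/Ps/map_f|apply: iinj; rewrite rK].
- exists (\sum_j kalg_str D (c j) * r (v j)); rewrite rmorph_sum bE.
  by apply: eq_bigr => j _; rewrite rmorphM khom_str rK.
Qed.

End LocalFiniteness.
End Heap.

(** * Points of affine heaps *)

Section ConstantOnSubheap.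
Variable k : closedFieldType.
Implicit Types A C T : kalg k.
Variable B : kalg k.
Variable t : forall T, khom B T -> khom B T -> khom B T -> khom B T.
Hypothesis heap_t : is_heap t.
Hypothesis B1 : (1 : B) <> 0.
Arguments t {T}.

(** The subheap is the fibre over a [k]-point [f] of a finitely generated
    subheap algebra [D].  The operation [t1] on points of [D] inherits its
    identities from [t] since tensor products of injections are injective.  A
    point of the fibre is [u w^-1 z], where [u] restricts to [f z^-1 w]. *)
Lemma function_constant_on_subheap (b : B) : exists (J : set B) (c : k),
  subheap_ideal (@t) J /\ J (b - kalg_str B c).
Proof.
have [tnat txxy txyy tA] := heap_t.
have [D [i [s [m [iinj Dgen mE [d0 d0E]]]]]] := function_in_finitely_generated_heap heap_t B1 b.
have D1 : (1 : D) <> 0 by move=> E; apply: B1; rewrite -(rmorph1 i) E rmorph0.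
have [f] := nullstellensatz D1 Dgen.
pose t1 T (a b' c : khom D T) : khom D T := khom_comp (tpair a (tpair b' c)) m.
have t1nat T S (g : khom T S) a b' c : khom_comp g (t1 T a b' c) =
    t1 S (khom_comp g a) (khom_comp g b') (khom_comp g c).
  by rewrite /t1 khom_compA !tpair_comp.
have t1i T (x y z : khom B T) :
    t1 T (khom_comp x i) (khom_comp y i) (khom_comp z i) = khom_comp (t x y z) i.
  rewrite /t1; have -> : tpair (khom_comp x i) (tpair (khom_comp y i) (khom_comp z i)) =
      khom_comp (tpair x (tpair y z)) (tmap i (tmap i i)).
    rewrite /tmap tpair_comp khom_compA tpair_in1; congr tpair.
    by rewrite khom_compA tpair_in2 tpair_comp !khom_compA tpair_in1 tpair_in2.
  rewrite -khom_compA mE khom_compA tnat; congr (khom_comp (t _ _ _) i).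
  - by rewrite tpair_in1.
  - by rewrite khom_compA tpair_in2 tpair_in1.
  - by rewrite khom_compA !tpair_in2.
have t1xxy T (a c : khom D T) : t1 T a a c = c.
  have E : t1 _ in1 in1 in2 = in2 :> khom D (tens D D).
    apply: (@khom_comp_inj _ _ _ _ (tmap i i)); first exact: tmap_inj.
    by rewrite t1nat /tmap tpair_in1 tpair_in2 t1i txxy.
  by rewrite -(tpair_in1 a c) -[in RHS](tpair_in2 a c) -E t1nat ?tpair_in1 ?tpair_in2.
have t1cancel T (a : khom D T) (z w : khom B T) :
    t1 T (t1 T a (khom_comp z i) (khom_comp w i)) (khom_comp w i) (khom_comp z i) = a.
  pose e (x : khom B T) : khom B (tens D T) := khom_comp in2 x.
  pose e' (x : khom B T) : khom B (tens B T) := khom_comp in2 x.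
  have E : t1 _ (t1 _ in1 (khom_comp (e z) i) (khom_comp (e w) i))
      (khom_comp (e w) i) (khom_comp (e z) i) = in1.
    have ee x : khom_comp (tmap i (khom_id T)) (khom_comp (e x) i) =
        khom_comp (e' x) i.
      by rewrite /e /e' /tmap !khom_compA tpair_in2 -!khom_compA khom_comp_id_l.
    apply: (@khom_comp_inj _ _ _ _ (tmap i (khom_id T))).
      by apply: tmap_inj => //; apply: inj_id.
    rewrite !t1nat !ee /tmap tpair_in1 !t1i tA.
    by rewrite (txxy _ (e' w)) txyy.
  have := congr1 (khom_comp (tpair a (khom_id T))) E.
  have e2 x : khom_comp (tpair a (khom_id T)) (khom_comp (e x) i) = khom_comp x i.
    by rewrite /e !khom_compA tpair_in2 khom_comp_id_l.
  by rewrite !t1nat !e2 tpair_in1.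
pose fT T : khom D T := khom_comp kstr f.
have fTnat T S (g : khom T S) : khom_comp g (fT T) = fT S.
  by rewrite /fT khom_compA khom_kstr.
(* [psi] composed with [z := f] is the identity, so [psi] is injective *)
pose psi := t1 _ (fT _) in1 in2 : khom D (tens D D).
have psiinj : injective psi.
  apply: (@can_inj _ _ _ (tpair (fT D) (khom_id D))) => d.
  rewrite -[LHS]/(khom_comp _ _ d) /psi t1nat fTnat tpair_in1 tpair_in2.
  by rewrite t1xxy.
pose phi := khom_comp (tmap i i) psi.
have phiinj : injective phi by apply: inj_comp psiinj; apply: tmap_inj.
have phiE : phi = t1 _ (fT _) (khom_comp in1 i) (khom_comp in2 i).
  by rewrite /phi /psi t1nat fTnat /tmap tpair_in1 tpair_in2.
have [L [u [w [L1 uw]]]] := amalgam iinj phiinj D1.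
pose y1 := khom_comp w in1; pose y2 := khom_comp w in2.
have yf : khom_comp (t u y2 y1) i = fT L.
  rewrite -t1i uw phiE t1nat fTnat !khom_compA.
  exact: t1cancel.
(* the functions that vanish on the fibre of [f], over every algebra [T] *)
pose J : set B := fun x => forall T (y : khom B T), khom_comp y i = fT T -> y x = 0.
have JP T (y : khom B T) : (forall x, J x -> y x = 0) -> khom_comp y i = fT T.
  move=> yJ; apply: khomP => d; apply/subr0_eq.
  have -> : fT T d = y (kalg_str B (f d)) by rewrite khom_str.
  rewrite /= -rmorphB; apply: yJ => S z zf.
  by rewrite rmorphB khom_str -[z (i d)]/(khom_comp z i d) zf subrr.
exists J, (f d0); split; last first.
  move=> T y yf'; rewrite -d0E rmorphB khom_str -[y (i d0)]/(khom_comp y i d0) yf'.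
  by rewrite subrr.
split.
- split=> [T y _|x y Jx Jy T z zf|a x Jx T z zf]; first by rewrite rmorph0.
    by rewrite rmorphD Jx // Jy // addr0.
  by rewrite rmorphM Jx // mulr0.
- by move/(_ _ _ yf); rewrite rmorph1.
- move=> T x1 x2 x3 /JP E1 /JP E2 /JP E3 x; apply.
  by rewrite -t1i E1 E2 E3 t1xxy.
Qed.

End ConstantOnSubheap.

Section HeapPoint.
Variable k : closedFieldType.
Variable B : kalg k.
Variable t : forall T, khom B T -> khom B T -> khom B T -> khom B T.
Hypothesis heap_t : is_heap t.
Hypothesis B1 : (1 : B) <> 0.

(** On a minimal nonempty closed subheap every function is constant, because it is
    constant on some nonempty closed subheap of it. *)
Lemma heap_has_point : inhabited (khom B (kalg_base k)).
Proof.
have [tnat txxy txyy tA] := heap_t.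
have [||J [_ Jsub Jmax]] := @Zorn_above B (subheap_ideal t) (fun x => x = 0).
- split=> [|/B1 //|T y1 y2 y3 _ _ _ x ->]; last by rewrite rmorph0.
  by split=> [|x y -> ->|a x ->]; rewrite ?addr0 ?mulr0.
- move=> F [X0 FX0] FP _ Ftot; split.
  + split.
    * by exists X0 => //; case: (FP _ FX0) => -[].
    * move=> x y [X FX Xx] [Y FY Yy]; have [XY|YX] := Ftot _ _ FX FY.
        by exists Y => //; case: (FP _ FY) => -[_ YD _] _ _; apply: YD => //; apply: XY.
      by exists X => //; case: (FP _ FX) => -[_ XD _] _ _; apply: XD => //; apply: YX.
    * move=> a x [X FX Xx]; exists X => //.
      by case: (FP _ FX) => -[_ _ XM] _ _; apply: XM.
  + by case=> X FX; case: (FP _ FX).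
  + move=> T y1 y2 y3 h1 h2 h3 x [X FX Xx]; case: (FP _ FX) => _ _.
    by apply=> // z Xz; [apply: h1|apply: h2|apply: h3]; exists X.
have [Jid J1 Jt] := Jsub.
have [Q [p [pE psurj]]] := quotient_exists Jid.
have Q1 : (1 : Q) <> 0 by rewrite -(rmorph1 p) => /pE.
have killp T (y : khom Q T) x : J x -> khom_comp y p x = 0.
  by move=> /pE /= ->; rewrite rmorph0.
have epi T (y y' : khom Q T) : khom_comp y p = khom_comp y' p -> y = y'.
  by move=> E; apply: khomP => q; have [x ->] := psurj q; apply: (khom_congr x E).
have exq T (x y z : khom Q T) : exists g : khom Q T,
    khom_comp g p = t (khom_comp x p) (khom_comp y p) (khom_comp z p).
  apply: surj_lift => // b /pE Jb.
  by apply: (Jt T _ _ _ _ _ _ b Jb) => c; apply: killp.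
pose tq T x y z := sval (cid (exq T x y z)).
have tqE T x y z : khom_comp (tq T x y z) p =
    t (khom_comp x p) (khom_comp y p) (khom_comp z p) := svalP (cid (exq T x y z)).
have heap_q : is_heap tq.
  split=> [T S g x y z|T x y|T x y|T x y z u v]; apply: epi.
  - by rewrite -khom_compA !tqE tnat !khom_compA.
  - by rewrite tqE txxy.
  - by rewrite tqE txyy.
  - by rewrite !tqE tA.
have const q : exists c, q = kalg_str Q c.
  have [J' [c [[J'id J'1 J't] J'q]]] := function_constant_on_subheap heap_q Q1 q.
  have [J'0 J'D J'M] := J'id.
  exists c; have [x xE] := psurj (q - kalg_str Q c).
  apply/subr0_eq; rewrite xE; apply/pE; rewrite xE in J'q.
  apply: (Jmax (fun b => J' (p b))) J'q.
    by move=> b /pE Jb; rewrite Jb.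
  split.
  - split; first by rewrite rmorph0.
      by move=> a b Ja Jb; rewrite rmorphD; apply: J'D.
    by move=> a b Jb; rewrite rmorphM; apply: J'M.
  - by rewrite rmorph1.
  - have low T (y : khom B T) : (forall b, J' (p b) -> y b = 0) ->
        exists2 g : khom Q T, khom_comp g p = y & forall q', J' q' -> g q' = 0.
      move=> yJ; have [|g gE] := @surj_lift k B Q T p y psurj.
        by move=> b pb; apply: yJ; rewrite pb.
      exists g => // q'; have [b ->] := psurj q' => /yJ <-.
      by rewrite -gE.
    move=> T y1 y2 y3 /low[g1 <- h1] /low[g2 <- h2] /low[g3 <- h3] b Jb.
    by rewrite -tqE /=; apply: J't Jb.
have [|g gE] := @inj_lift k Q Q (kalg_base k) (@kstr k Q) (khom_id Q) (kstr_inj Q1).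
  by move=> q; have [c ->] := const q; exists c.
exact: (inhabits (khom_comp g p)).
Qed.

End HeapPoint.

(** * From torsors to heaps *)

(* [pmap] otherwise denotes the partial map on sequences *)
Local Notation pmap := Defs.pmap.

Section AffineTorsor.
Variable k : closedFieldType.
Implicit Types T R S : kalg k.
Variables (A : kalg k) (X : kfunctor k).
Variable act : forall T, X T -> khom A T -> X T.
Variable dl : forall T, X T -> X T -> khom A T.
Arguments act {T}.
Arguments dl {T}.
Hypothesis act_nat : forall T S (f : khom T S) x g,
  pmap X f (act x g) = act (pmap X f x) (khom_comp f g).
Hypothesis dl_nat : forall T S (f : khom T S) x y,
  khom_comp f (dl x y) = dl (pmap X f x) (pmap X f y).
Hypothesis actK : forall T (x : X T) g, dl x (act x g) = g.
Hypothesis dlK : forall T (x y : X T), act x (dl x y) = y.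
Hypothesis act_diag : forall T (x y : X T), act x (dl y y) = x.
Hypothesis act_assoc : forall T (a b c d e : X T),
  act (act a (dl b c)) (dl d e) = act a (dl b (act c (dl d e))).

(** Points over a subalgebra are determined by their images because the group
    element that relates them is a homomorphism out of [A]. *)
Lemma torsor_points_inj T S (f : khom T S) : injective f -> injective (pmap X f).
Proof.
move=> finj x y E; rewrite -(dlK x y) -[LHS](dlK x x); congr act.
by apply: (khom_comp_inj finj); rewrite !dl_nat E.
Qed.

Variables (K : kalg k) (x : X K).
Hypothesis K1 : (1 : K) <> 0.
Hypothesis A1 : (1 : A) <> 0.

(** A descent datum for [T -> K (x) T]: all pullbacks of [eta] along maps that
    agree on [T] coincide. *)
Definition descends T (eta : X (tens K T)) : Prop :=
  forall R (s s' : khom K R) (g : khom T R),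
    pmap X (tpair s g) eta = pmap X (tpair s' g) eta.

(* the universal point of [X] over [K]-algebras, and the element of [G] that
   carries [x], over another copy of [K], to it *)
Let ytilde : X (tens K A) := act (pmap X in1 x) in2.
Let Gamma : khom A (tens K (tens K A)) := dl (pmap X in1 x) (pmap X in2 ytilde).

(** [B] is generated by the coefficients in [K (x) A] of [Gamma].  Given a descent
    datum [eta] over [T], the map [K (x) A -> K (x) T] that classifies [eta] sends
    these coefficients into [T], since [eta] may be compared with [x] over either
    copy of [K]; this is the map [B -> T] that classifies the descended point. *)
Lemma descended_algebra : exists (B : kalg k) (yB : X (tens K B)),
  [/\ (1 : B) <> 0, descends yB,
      forall T (y y' : khom B T),
        pmap X (tmapr K y) yB = pmap X (tmapr K y') yB -> y = y' &
      forall T (eta : X (tens K T)), descends eta ->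
        exists y : khom B T, pmap X (tmapr K y) yB = eta].
Proof.
have [B [i [iinj igens igen]]] := generated_algebra (fun b : tens K A =>
  exists a (lam : K -> k) (llam : klin lam), b = slice llam (Gamma a)).
have iKinj : injective (tmapr K i) by apply: tmapr_inj.
have [|GB GBE] := @inj_lift k A _ (tens K B) (tmapr K i) Gamma iKinj.
  move=> a; have [s [GamE sE]] := tens_slices (Gamma a); rewrite {}GamE.
  apply: (subalgebra_sum (khom_image_subalgebra (tmapr K i))) => p ps.
  have [[lam [llam pE]] _] := sE p ps.
  have [|d dE] := igens p.2; first by exists a, lam, llam.
  by exists (in1 p.1 * in2 d); rewrite tpairE /= dE.
pose yB : X (tens K B) := act (pmap X in1 x) GB.
have yBE T (y : khom B T) :
    pmap X (tmapr K y) yB = act (pmap X in1 x) (khom_comp (tmapr K y) GB).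
  by rewrite act_nat -pmap_comp tmapr_in1.
have univ : pmap X (tmapr K i) yB = pmap X in2 ytilde by rewrite yBE GBE dlK.
have yBd : descends yB.
  move=> R s s' g.
  pose s0 : khom K (tens K (tens K B)) := in1.
  pose s1 : khom K (tens K (tens K B)) := khom_comp in2 in1.
  pose g0 : khom B (tens K (tens K B)) := khom_comp in2 in2.
  have E : pmap X (tpair s0 g0) yB = pmap X (tpair s1 g0) yB.
    have einj : injective (tmapr K (tmapr K i)) by apply: tmapr_inj.
    apply: (torsor_points_inj einj); rewrite -!pmap_comp !tpair_comp.
    rewrite /s0 /s1 /g0 tmapr_in1 !khom_compA tmapr_in2 -!khom_compA.
    rewrite tmapr_in1 tmapr_in2.
    by rewrite (khom_compA in2) -!tpair_tmapr !pmap_comp univ -!pmap_comp !tpair_tmapr !tpair_in2.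
  have := congr1 (pmap X (tpair s (tpair s' g))) E.
  rewrite -!pmap_comp !tpair_comp /s0 /s1 /g0 tpair_in1 !khom_compA !tpair_in2.
  by rewrite tpair_in1.
exists B, yB; split=> //.
- move=> E; apply: (tens_nonzero K1 A1).
  by rewrite -(rmorph1 i) E rmorph0.
- move=> T y y'; rewrite !yBE => /(congr1 (dl (pmap X in1 x))); rewrite !actK => E.
  apply: khomP; apply: igen; first exact: khom_equalizer_subalgebra.
  move=> c [a [lam [llam]]]; rewrite -GBE /= slice_natural => /iinj ->.
  rewrite -!slice_natural; congr (slice llam _).
  exact: (khom_congr a E).
move=> T eta etad.
pose h : khom A (tens K T) := dl (pmap X in1 x) eta.
pose theta : khom (tens K A) (tens K T) := tpair in1 h.
have thetaE : pmap X theta ytilde = eta.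
  by rewrite act_nat -pmap_comp tpair_in1 tpair_in2 dlK.
have E : khom_comp (tmapr K theta) Gamma = khom_comp (tmapr K in2) h.
  rewrite !dl_nat -!pmap_comp !tmapr_in1 tmapr_in2; congr (dl _ _).
  rewrite pmap_comp thetaE /tmapr (etad _ _ (khom_comp in2 in1)).
  by congr (pmap X _ eta); apply: tens_ext; rewrite ?tpair_in1 ?tpair_in2.
have T2inj : injective (@in2 k K T) by apply: in2_inj.
have [|y yE] := @inj_lift k B (tens K T) _ in2 (khom_comp theta i) T2inj.
  apply: (igen (fun b => exists c, in2 c = theta (i b))).
    exact: (khom_preimage_subalgebra (khom_comp theta i) (khom_image_subalgebra in2)).
  move=> b [a [lam [llam bE]]]; exists (slice llam (h a)).
  rewrite bE -!slice_natural; congr (slice llam _).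
  by rewrite -[LHS]/(khom_comp (tmapr K in2) h a) -E.
exists y; rewrite yBE -[RHS](dlK (pmap X in1 x)); congr act.
have T3inj : injective (tmapr K (@in2 k K T)) by apply: tmapr_inj.
apply: (khom_comp_inj T3inj).
by rewrite khom_compA tmapr_comp yE -tmapr_comp -khom_compA GBE E.
Qed.

(** The descended functor is an affine heap; a [k]-point of it, specialized along
    [K (x) k -> K], is the required point. *)
Lemma torsor_descended_point : exists z : X K, forall R (s s' : khom K R),
  pmap X s z = pmap X s' z.
Proof.
have [B [yB [B1 yBd yinj ysurj]]] := descended_algebra.
pose eta T (y : khom B T) := pmap X (tmapr K y) yB.
have etad T (y : khom B T) : descends (eta T y).
  by move=> R s s' g; rewrite -!pmap_comp !tpair_tmapr; apply: yBd.
have etaN T S (g : khom T S) y : pmap X (tmapr K g) (eta T y) = eta S (khom_comp g y).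
  by rewrite -pmap_comp tmapr_comp.
have ex T (y1 y2 y3 : khom B T) : exists y,
    eta T y = act (eta T y1) (dl (eta T y2) (eta T y3)).
  apply: ysurj => R s s' g; rewrite !act_nat !dl_nat.
  by rewrite (etad T y1 R s s') (etad T y2 R s s') (etad T y3 R s s').
pose t T y1 y2 y3 := sval (cid (ex T y1 y2 y3)).
have tE T y1 y2 y3 : eta T (t T y1 y2 y3) =
    act (eta T y1) (dl (eta T y2) (eta T y3)) := svalP (cid (ex T y1 y2 y3)).
have heap_t : is_heap t.
  split=> [T S g u v w|T u v|T u v|T a b c d e]; apply: yinj; rewrite -!/(eta _ _).
  - by rewrite -etaN !tE act_nat dl_nat !etaN.
  - by rewrite tE dlK.
  - by rewrite tE act_diag.
  - by rewrite !tE act_assoc.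
have [y] := heap_has_point heap_t B1.
move: (eta _ y) (etad _ y) => w wd.
exists (pmap X (tpair (khom_id K) kstr) w) => R s s'.
rewrite -!pmap_comp !tpair_comp !khom_kstr.
by rewrite !khom_comp_id_r; apply: wd.
Qed.

End AffineTorsor.

(** The point lies in an affine open [Spec C]; the corresponding map [C -> K] has
    equal composites with the two maps [K -> K (x) K], hence takes scalar
    values. *)
Lemma scheme_field_descent (k : fieldType) (X : kfunctor k) (K : kalg k) (z : X K) :
  is_scheme X -> is_field K ->
  (forall R (s s' : khom K R), pmap X s z = pmap X s' z) ->
  inhabited (X (kalg_base k)).
Proof.
move=> [_ [I [U [Uaff Ucov]]]] Kf zc.
have [j Uz] := Ucov K Kf z.
have [_ [C [f [g [gf fg]]]]] := Uaff j.
pose c : khom C K := mor g (exist _ z Uz : subF (U j) K).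
have cE : khom_comp in1 c = khom_comp in2 c :> khom C (tens K K).
  rewrite -[LHS](mor_nat g) -[RHS](mor_nat g); congr (mor g).
  by apply: eq_exist => /=; apply: zc.
have [K1 _] := Kf.
have [|c0 _] := @inj_lift k C K (kalg_base k) kstr c (kstr_inj K1).
  move=> a; have /in1_eq_in2_scalar[//|d dE] := khom_congr a cE.
  by exists d.
by case: (mor f c0) => y _; exists.
Qed.

Theorem theorem1p1 (k : closedFieldType) (G : group_scheme k) (hG : is_affine G)
  (X : gspace G) (hX : is_torsor X) : inhabited (X (kalg_base k)).
Proof.
case: hG hX => A [F [E [FE EF]]] [[K [Kf [x]]] [m [mK Km]]].
have m1 T (a b : X T) : (mor m ((a, b) : prodF X X T)).1 = a.
  by have := congr1 fst (Km T (a, b)).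
(* the action and the division map, transported along [Spec A = G] *)
pose act T (a : X T) (g : khom A T) : X T := mor (sp_act X) ((a, mor F g) : prodF X G T).
pose gd T (a b : X T) : G T := (mor m ((a, b) : prodF X X T)).2.
pose dl T (a b : X T) : khom A T := mor E (gd T a b).
have gdK T (a b : X T) : mor (sp_act X) ((a, gd T a b) : prodF X G T) = b.
  have := congr1 snd (Km T (a, b)); rewrite /= -{2}(m1 T a b).
  by rewrite /gd -surjective_pairing.
have gdE T (a : X T) (g : G T) : gd T a (mor (sp_act X) ((a, g) : prodF X G T)) = g.
  exact: (congr1 snd (mK T (a, g))).
have actdl T (a b c : X T) :
    act T a (dl T b c) = mor (sp_act X) ((a, gd T b c) : prodF X G T).
  by rewrite /act /dl EF.
have A1 : (1 : A) <> 0.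
  pose e := mor E (mor (gs_one G) (khom_id (kalg_base k) : Spec _ _)) : khom A (kalg_base k).
  move=> A1; have /eqP := rmorph1 e; rewrite A1 rmorph0 eq_sym.
  by rewrite (oner_eq0 k).
have [||||||z zc] := @torsor_descended_point k A X act dl _ _ _ _ _ _ K x Kf.1 A1.
- move=> T S f a g; rewrite /act -(mor_nat (sp_act X)); congr (mor (sp_act X)).
  by congr pair; rewrite -(mor_nat F).
- move=> T S f a b; rewrite /dl -[LHS](mor_nat E); congr (mor E _).
  by rewrite /gd -[LHS]/(pmap (prodF X G) f _).2 -(mor_nat m).
- by move=> T a g; rewrite /act /dl gdE FE.
- by move=> T a b; rewrite actdl gdK.
- move=> T a b; rewrite actdl.
  have -> : gd T b b = mor (gs_one G) (kstr : Spec (kalg_base k) T).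
    by rewrite -{2}(sp_act1 kstr b) gdE.
  exact: sp_act1.
- move=> T a b c d e; rewrite !actdl -sp_actM; congr (mor (sp_act X)); congr pair.
  by rewrite -{2}(gdK T b c) -sp_actM gdE.
exact: (scheme_field_descent (sp_scheme X) Kf zc).
Qed.
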